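(* Let $d\ge1$. Suppose that $c_1>0$ is a constant and $\beta:(0,+\infty)\to[0,+\infty)$ is a function such that $$\|L_\Omega\|_{\mathrm{HS}}^2\le \|L_{\Omega^*}\|_{\mathrm{HS}}^2-c_1\,\beta(|\Omega|)\,\alpha[\Omega]^2$$ for every measurable subset $\Omega\subset\mathbb{R}^{2d}$ of positive finite measure. Then there exist constants $C>0$ and $t_0>0$ such that $\beta(t)\le C\,t^{2+\frac1d}$ for all $0<t<t_0$.
   Context: $|\cdot|$ denotes Lebesgue measure on $\mathbb{R}^{2d}$. Let $\varphi(x)=2^{d/4}e^{-\pi|x|^2}$, $x\in\mathbb{R}^d$, and for $f\in L^2(\mathbb{R}^d)$ let $\mathcal{V}f(x,\omega)=\int_{\mathbb{R}^d}f(y)\overline{\varphi(y-x)}e^{-2\pi i\omega\cdot y}\,dy$, $(x,\omega)\in\mathbb{R}^d\times\mathbb{R}^d$, be the short-time Fourier transform with Gaussian window; $\mathcal{V}:L^2(\mathbb{R}^d)\to L^2(\mathbb{R}^{2d})$ is an isometry. For a measurable $\Omega\subset\mathbb{R}^{2d}$ of finite measure, the time-frequency localization operator is $L_\Omega=\mathcal{V}^*\chi_\Omega\mathcal{V}:L^2(\mathbb{R}^d)\to L^2(\mathbb{R}^d)$, i.e. $\langle L_\Omega f,g\rangle=\int_\Omega \mathcal{V}f(z)\overline{\mathcal{V}g(z)}\,dz$. $\|\cdot\|_{\mathrm{HS}}$ is the Hilbert-Schmidt norm. $\Omega^*$ is the open ball in $\mathbb{R}^{2d}$ centered at $0$ with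 $|\Omega^*|=|\Omega|$. The Fraenkel asymmetry index is $$\alpha[\Omega]=\inf\left\{\frac{|\Omega\triangle B|}{|\Omega|}: B\subset\mathbb{R}^{2d}\text{ is a ball of measure }|B|=|\Omega|\right\},$$ with $\Omega\triangle B=(\Omega\setminus B)\cup(B\setminus\Omega)$. *)

(* Defs.v *)
From HB Require Import structures.
From mathcomp Require Import all_boot all_order all_algebra.
From mathcomp Require Import complex.
From mathcomp Require Import all_classical all_reals all_analysis.

Set Implicit Arguments.
Unset Strict Implicit.
Unset Printing Implicit Defensive.
Import Order.TTheory GRing.Theory Num.Theory.
Import numFieldNormedType.Exports.
Local Open Scope classical_set_scope.
Local Open Scope complex_scope.
Local Open Scope ring_scope.

(* The n-fold product of a sigma-finite measure, on n-tuples with the product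
   sigma-algebra. For Lebesgue measure on R this sigma-algebra is the Borel one,
   so `measurable' below means Borel measurable; Lebesgue measurable sets and
   functions agree with Borel ones up to null sets. *)
Section power_measure.
Context d (T : measurableType d) (R : realType).
Variable mu : {sigma_finite_measure set T -> \bar R}.
Local Open Scope ereal_scope.

Section step.
Variables (n : nat) (m : {sigma_finite_measure set (n.-tuple T) -> \bar R}).

Definition tcons (p : T * n.-tuple T) : n.+1.-tuple T := [tuple of p.1 :: p.2].

Lemma measurable_tcons : measurable_fun setT tcons.
Proof. exact: measurable_cons. Qed.

Definition cons_measure : set (n.+1.-tuple T) -> \bar R :=
  pushforward (mu \x m) tcons.

Let cons_measure0 : cons_measure set0 = 0.
Proof. by rewrite /cons_measure /pushforward preimage_set0 measure0. Qed.

Let cons_measure_ge0 A : 0 <= cons_measure A.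
Proof. by rewrite /cons_measure /pushforward measure_ge0. Qed.

Let cons_measure_sigma_additive : semi_sigma_additive cons_measure.
Proof. by apply: measure_semi_sigma_additive; exact: measurable_tcons. Qed.

HB.instance Definition _ := isMeasure.Build _ _ _ cons_measure
  cons_measure0 cons_measure_ge0 cons_measure_sigma_additive.

Let cons_measure_sigma_finite : sigma_finite setT cons_measure.
Proof.
have /sigma_finiteP[F [FT ndF mF]] := sigma_finiteT mu.
have /sigma_finiteP[G [GT ndG mG]] := sigma_finiteT m.
pose uncons (x : n.+1.-tuple T) := (thead x, [tuple of behead x]).
have muncons : measurable_fun setT uncons.
  apply: measurable_fun_pair; [exact: measurable_tnth|exact: measurable_behead].
have tconsK : cancel tcons uncons by case=> a t; congr pair; apply/val_inj.
exists (fun k => uncons @^-1` (F k `*` G k)).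
  apply/esym; rewrite -subTset => x _.
  have [i _ Fi] : (\bigcup_i F i) (uncons x).1 by rewrite -FT.
  have [j _ Gj] : (\bigcup_i G i) (uncons x).2 by rewrite -GT.
  exists (maxn i j) => //; split.
    by move: Fi; exact/subsetPset/ndF/leq_maxl.
  by move: Gj; exact/subsetPset/ndG/leq_maxr.
move=> k; have [mFk Fk] := mF k; have [mGk Gk] := mG k; split.
  by rewrite -[X in measurable X]setTI; apply: muncons => //; exact: measurableX.
rewrite /cons_measure /pushforward -comp_preimage.
rewrite (_ : uncons \o tcons = id) ?preimage_id; last exact/funext.
by rewrite product_measure1E// lte_mul_pinfty// ge0_fin_numE.
Qed.

HB.instance Definition _ := Measure_isSigmaFinite.Build _ _ _ cons_measure
  cons_measure_sigma_finite.

End step.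

Fixpoint power_measure n : {sigma_finite_measure set (n.-tuple T) -> \bar R} :=
  if n is n'.+1 then cons_measure (power_measure n') else \d_ [tuple].

End power_measure.

Notation Rn R n := (n.-tuple (measurableTypeR R)).

Definition lebesgue (R : realType) (n : nat) :
    {sigma_finite_measure set (Rn R n) -> \bar R} :=
  power_measure lebesgue_measure n.

(* R^2d is represented as R^d * R^d, with pairs (x, omega). *)
Definition lebesgue2 (R : realType) (d : nat) :
    {measure set (Rn R d * Rn R d)%type -> \bar R} :=
  (lebesgue R d \x lebesgue R d)%E.

(* Elements of the complex space L^2(mu) are represented by functions; equality
   in L^2 is equality almost everywhere. *)
Section complex_L2.
Context d (T : measurableType d) (R : realType).
Variable mu : {measure set T -> \bar R}.
Implicit Types f g : T -> R[i].

Definition Cintegral (D : set T) f : R[i] :=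
  (\int[mu]_(x in D) complex.Re (f x)) +i*
  (\int[mu]_(x in D) complex.Im (f x)).

Definition normsq f : \bar R :=
  (\int[mu]_x (complex.Re (f x) ^+ 2 + complex.Im (f x) ^+ 2)%:E)%E.

Definition L2fun f :=
  [/\ measurable_fun setT (fun x => complex.Re (f x)),
      measurable_fun setT (fun x => complex.Im (f x)) &
      (normsq f < +oo)%E].

Definition inner f g : R[i] := Cintegral setT (fun x => f x * conjc (g x)).

Definition orthonormal (E : set (T -> R[i])) :=
  (forall e, E e -> inner e e = 1) /\
  (forall e e', E e -> E e' -> e <> e' -> inner e e' = 0).

Definition orthonormal_basis (E : set (T -> R[i])) :=
  [/\ E `<=` L2fun, orthonormal E &
      forall f, L2fun f -> (forall e, E e -> inner f e = 0) ->
        {ae mu, forall x, f x = 0}].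

(* The squared Hilbert-Schmidt norm sum_e |A e|^2. For a bounded operator the sum
   has the same value, possibly +oo, for every orthonormal basis, so the supremum
   only selects that common value. *)
Definition hsnormsq (A : (T -> R[i]) -> (T -> R[i])) : \bar R :=
  ereal_sup [set (\esum_(e in E) normsq (A e))%E | E in orthonormal_basis].

End complex_L2.

(* The value at F of the Hilbert adjoint of A : L^2(mu1) -> L^2(mu2); the
   function h is determined up to a mu1-null set. *)
Definition hadjoint d1 d2 (T1 : measurableType d1) (T2 : measurableType d2)
    (R : realType) (mu1 : {measure set T1 -> \bar R})
    (mu2 : {measure set T2 -> \bar R})
    (A : (T1 -> R[i]) -> (T2 -> R[i])) (F : T2 -> R[i]) : T1 -> R[i] :=
  xget (fun=> 0) [set h | L2fun mu1 h /\
    forall g, L2fun mu1 g -> inner mu1 h g = inner mu2 F (A g)].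

Section time_frequency.
Context {R : realType} {d : nat}.
Implicit Types (x y : Rn R d) (z : (Rn R d * Rn R d)%type)
  (Omega : set (Rn R d * Rn R d)).

Definition dot x y : R := \sum_(i < d) tnth x i * tnth y i.

Definition tsub x y : Rn R d := [tuple tnth x i - tnth y i | i < d].

Definition gaussian x : R := 2 `^ (d%:R / 4) * expR (- pi * dot x x).

(* exp(i t) *)
Definition expi (t : R) : R[i] := cos t +i* sin t.

Definition stft (f : Rn R d -> R[i]) z : R[i] :=
  Cintegral (lebesgue R d) setT (fun y =>
    f y * conjc (gaussian (tsub y z.1))%:C * expi (- 2 * pi * dot z.2 y)).

Definition locop Omega (f : Rn R d -> R[i]) : Rn R d -> R[i] :=
  hadjoint (lebesgue R d) (lebesgue2 R d) stft
    (fun z => (\1_Omega z)%:C * stft f z).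

Definition ball2 (c : (Rn R d * Rn R d)%type) (r : R) :
    set (Rn R d * Rn R d) :=
  [set z | Num.sqrt (dot (tsub z.1 c.1) (tsub z.1 c.1) +
                     dot (tsub z.2 c.2) (tsub z.2 c.2)) < r].

Definition origin : Rn R d := [tuple 0 | i < d].

(* For 0 < |Omega| < +oo exactly one such ball exists. *)
Definition symm_ball Omega : set (Rn R d * Rn R d) :=
  xget set0 [set B | (exists r, B = ball2 (origin, origin) r) /\
                     lebesgue2 R d B = lebesgue2 R d Omega].

Definition fraenkel Omega : R :=
  inf [set fine (lebesgue2 R d (Omega `+` B)) / fine (lebesgue2 R d Omega)
      | B in [set B | (exists c r, B = ball2 c r) /\
                      lebesgue2 R d B = lebesgue2 R d Omega]].

End time_frequency.

(* Main.v *)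
From HB Require Import structures.
Require Import Defs.
From mathcomp Require Import all_boot all_order all_algebra.
From mathcomp Require Import complex ring lra.
From mathcomp Require Import all_classical all_reals all_analysis.
From mathcomp Require Import measurable_realfun.
Set Implicit Arguments.
Unset Strict Implicit.
Unset Printing Implicit Defensive.
Import Order.TTheory GRing.Theory Num.Theory.
Import numFieldNormedType.Exports.
Local Open Scope classical_set_scope.
Local Open Scope complex_scope.
Local Open Scope ring_scope.

(** Write V f for the short-time Fourier transform, phi_z for the
    time-frequency shift of the Gaussian phi by z, and t for |Omega|.  Since
    V f z = <f, phi_z> and every phi_z is a unit vector, V f is controlled by
    Bessel's inequality.

    _Upper bound._  The squared Hilbert-Schmidt norm of L_Omega is at most t^2
    for every Omega, in particular for a ball ([hsnormsq_locop_le]).  Indeed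
    |L e|^2 = <chi V e, V (L e)> and |V (L e) z|^2 <= |L e|^2 give
    |L e|^2 <= t * int_Omega |V e|^2, and summing over an orthonormal family,
    Bessel's inequality for phi_z bounds the sum of the |V e z|^2 by 1.

    _Lower bound._  If Omega lies within distance sqrt r of 0, then L_Omega is
    nearly t times the projection onto phi: some orthonormal basis contains phi
    ([exists_onb_mem]), so the squared Hilbert-Schmidt norm is at least
    |L phi|^2 >= <L phi, phi>^2 = (int_Omega |V phi|^2)^2, and
    Re (V phi z) >= 1 - C |z|^2 ([Re_stft_gaussian_ge]).  This gives
    t^2 (1 - O(r)) ([hsnormsq_locop_gaussian_ge]).

    _Test set._  Let Omega be the union of two cubes with side s and total
    measure t = 2 s^(2d), at distance 4 d s from each other.  A ball of measure
    t has radius at most 2 d s, hence misses one of the cubes, so the asymmetry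
    index of Omega is at least 1/2 ([fraenkel_two_cubes_ge]).  As Omega lies
    within distance O(s) of 0, the deficit is at most t^2 O(s^2), which is
    O(t^(2 + 1/d)), while the stability hypothesis bounds it from below by
    c1 * beta t / 4. *)

(** * Complex numbers in coordinates *)

Local Notation Re := complex.Re.
Local Notation Im := complex.Im.

Section components.
Context {R : realType}.
Implicit Types z w : R[i].

Definition sqmod z : R := Re z ^+ 2 + Im z ^+ 2.

Lemma sqmod_ge0 z : 0 <= sqmod z.
Proof. by rewrite addr_ge0 ?sqr_ge0. Qed.

Lemma Re_mul z w : Re (z * w) = Re z * Re w - Im z * Im w.
Proof. by case: z w => [a b] [c d]. Qed.

Lemma Im_mul z w : Im (z * w) = Re z * Im w + Im z * Re w.
Proof. by case: z w => [a b] [c d]. Qed.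

Lemma Re_add z w : Re (z + w) = Re z + Re w.
Proof. by case: z w => [a b] [c d]. Qed.

Lemma Im_add z w : Im (z + w) = Im z + Im w.
Proof. by case: z w => [a b] [c d]. Qed.

Lemma Re_opp z : Re (- z) = - Re z. Proof. by case: z. Qed.

Lemma Im_opp z : Im (- z) = - Im z. Proof. by case: z. Qed.

Lemma Re_conjc z : Re (conjc z) = Re z. Proof. by case: z. Qed.

Lemma Im_conjc z : Im (conjc z) = - Im z. Proof. by case: z. Qed.

Lemma complexP z w : Re z = Re w -> Im z = Im w -> z = w.
Proof. by case: z w => [a b] [c d] /= -> ->. Qed.

Lemma sqmodM z w : sqmod (z * w) = sqmod z * sqmod w.
Proof. by rewrite /sqmod Re_mul Im_mul; ring. Qed.

Lemma sqmod_conj z : sqmod (conjc z) = sqmod z.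
Proof. by rewrite /sqmod Re_conjc Im_conjc sqrrN. Qed.

Lemma conjc_mul z w : conjc (z * w) = conjc z * conjc w.
Proof. by apply: complexP; rewrite !(Re_conjc, Im_conjc, Re_mul, Im_mul); ring. Qed.

Lemma mul_conjc z : z * conjc z = (sqmod z)%:C.
Proof.
by apply: complexP; rewrite !(Re_conjc, Im_conjc, Re_mul, Im_mul) /sqmod /=; ring.
Qed.

Lemma Re_realM (a : R) z : Re (a%:C * z) = a * Re z.
Proof. by rewrite Re_mul /= mul0r subr0. Qed.

Lemma Im_realM (a : R) z : Im (a%:C * z) = a * Im z.
Proof. by rewrite Im_mul /= mul0r addr0. Qed.

Lemma ReM_conj_le z w : `|Re (z * conjc w)| <= sqmod z + sqmod w.
Proof.
rewrite Re_mul Re_conjc Im_conjc /sqmod.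
case: z w => [a b] [c d] /=; rewrite ler_norml; apply/andP.
have := (sqr_ge0 (a + c), sqr_ge0 (a - c), sqr_ge0 (b + d), sqr_ge0 (b - d)).
rewrite !sqrrB !sqrrD => -[[[]]] h1 h2 h3 h4.
have := (sqr_ge0 a, sqr_ge0 b, sqr_ge0 c, sqr_ge0 d) => -[[[]]].
by split; lra.
Qed.

Lemma ImM_conj_le z w : `|Im (z * conjc w)| <= sqmod z + sqmod w.
Proof.
rewrite Im_mul Re_conjc Im_conjc /sqmod.
case: z w => [a b] [c d] /=; rewrite ler_norml; apply/andP.
have := (sqr_ge0 (a + d), sqr_ge0 (a - d), sqr_ge0 (b + c), sqr_ge0 (b - c)).
rewrite !sqrrB !sqrrD => -[[[]]] h1 h2 h3 h4.
have := (sqr_ge0 a, sqr_ge0 b, sqr_ge0 c, sqr_ge0 d) => -[[[]]].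
by split; lra.
Qed.

Lemma sqmodD_le z w : sqmod (z + w) <= 2 * sqmod z + 2 * sqmod w.
Proof.
rewrite /sqmod !(Re_add, Im_add); case: z w => [a b] [c d] /=.
have := (sqr_ge0 (a - c), sqr_ge0 (b - d)); rewrite !sqrrB !sqrrD => -[h1 h2].
by lra.
Qed.

End components.

Definition cE := (@Re_mul, @Im_mul, @Re_add, @Im_add, @Re_opp, @Im_opp,
  @Re_conjc, @Im_conjc).

(** * The complex space L2 *)

Section complex_integral.
Context d (T : measurableType d) (R : realType).
Variable mu : {measure set T -> \bar R}.
Implicit Types f g h : T -> R[i].

Lemma integrable_scale a (u : T -> R) : mu.-integrable setT (EFin \o u) ->
  mu.-integrable setT (EFin \o (fun x => a * u x)).
Proof. exact: (@integrableZl _ _ _ mu _ measurableT a (EFin \o u)). Qed.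

Lemma integrable_add (u v : T -> R) : mu.-integrable setT (EFin \o u) ->
  mu.-integrable setT (EFin \o v) ->
  mu.-integrable setT (EFin \o (fun x => u x + v x)).
Proof.
by move=> iu iv; exact: (@integrableD _ _ _ mu _ measurableT _ _ iu iv).
Qed.

Definition cmeasurable f :=
  measurable_fun setT (fun x => Re (f x)) /\
  measurable_fun setT (fun x => Im (f x)).

Definition cintegrable f :=
  mu.-integrable setT (EFin \o (fun x => Re (f x))) /\
  mu.-integrable setT (EFin \o (fun x => Im (f x))).

Lemma cmeasurableM f g : cmeasurable f -> cmeasurable g ->
  cmeasurable (fun x => f x * g x).
Proof.
move=> [f1 f2] [g1 g2]; split.
- under eq_fun do rewrite Re_mul.
  by apply: measurable_funB; apply: measurable_funM.
- under eq_fun do rewrite Im_mul.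
  by apply: measurable_funD; apply: measurable_funM.
Qed.

Lemma cmeasurableD f g : cmeasurable f -> cmeasurable g ->
  cmeasurable (fun x => f x + g x).
Proof.
move=> [f1 f2] [g1 g2]; split.
- by under eq_fun do rewrite Re_add; exact: measurable_funD.
- by under eq_fun do rewrite Im_add; exact: measurable_funD.
Qed.

Lemma cmeasurable_cst (c : R[i]) : cmeasurable (cst c).
Proof. by split; exact: measurable_cst. Qed.

Lemma cmeasurable_conj f : cmeasurable f -> cmeasurable (fun x => conjc (f x)).
Proof.
move=> [f1 f2]; split; first by under eq_fun do rewrite Re_conjc.
by under eq_fun do rewrite Im_conjc; exact: measurableT_comp.
Qed.

Lemma cmeasurable_real (u : T -> R) : measurable_fun setT u ->
  cmeasurable (fun x => (u x)%:C).
Proof. by move=> mu'; split => //=; exact: measurable_cst. Qed.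

Lemma measurable_sqmod f : cmeasurable f ->
  measurable_fun setT (fun x => sqmod (f x)).
Proof.
by move=> [f1 f2]; apply: measurable_funD; apply: measurable_funX.
Qed.

Lemma cintegrable_le f (b : T -> R) : cmeasurable f ->
  mu.-integrable setT (EFin \o b) ->
  (forall x, `|Re (f x)| <= b x) -> (forall x, `|Im (f x)| <= b x) ->
  cintegrable f.
Proof.
move=> [f1 f2] ib fb1 fb2; split; apply: le_integrable ib => //.
- exact/measurable_EFinP.
- by move=> x _ /=; rewrite lee_fin (le_trans (fb1 x))// ler_norm.
- exact/measurable_EFinP.
- by move=> x _ /=; rewrite lee_fin (le_trans (fb2 x))// ler_norm.
Qed.

Lemma cintegrableZ (c : R[i]) f : cintegrable f ->
  cintegrable (fun x => c * f x).
Proof.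
move=> [f1 f2]; split.
- have -> : EFin \o (fun x => Re (c * f x)) = (fun x =>
    (Re c)%:E * (EFin \o (fun x => Re (f x))) x -
    (Im c)%:E * (EFin \o (fun x => Im (f x))) x)%E.
    by apply/funext => x; rewrite /= Re_mul.
  by apply: integrableB => //; exact: integrableZl.
- have -> : EFin \o (fun x => Im (c * f x)) = (fun x =>
    (Re c)%:E * (EFin \o (fun x => Im (f x))) x +
    (Im c)%:E * (EFin \o (fun x => Re (f x))) x)%E.
    by apply/funext => x; rewrite /= Im_mul.
  by apply: integrableD => //; exact: integrableZl.
Qed.

Lemma CintegralD f g : cintegrable f -> cintegrable g ->
  Cintegral mu setT (fun x => f x + g x) =
  Cintegral mu setT f + Cintegral mu setT g.
Proof.
move=> [f1 f2] [g1 g2]; apply: complexP; rewrite !cE/= -RintegralD//.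
- by apply: eq_Rintegral => x _; rewrite Re_add.
- by apply: eq_Rintegral => x _; rewrite Im_add.
Qed.

Lemma CintegralZl (c : R[i]) f : cintegrable f ->
  Cintegral mu setT (fun x => c * f x) = c * Cintegral mu setT f.
Proof.
move=> [f1 f2]; apply: complexP; rewrite !cE/= -!RintegralZl//.
- rewrite -RintegralB//; [|exact: integrable_scale..].
  by apply: eq_Rintegral => x _; rewrite Re_mul.
- rewrite -RintegralD//; [|exact: integrable_scale..].
  by apply: eq_Rintegral => x _; rewrite Im_mul.
Qed.

Lemma Cintegral_conj f : cintegrable f ->
  Cintegral mu setT (fun x => conjc (f x)) = conjc (Cintegral mu setT f).
Proof.
move=> [f1 f2]; apply: complexP; rewrite !cE/=.
- by apply: eq_Rintegral => x _; rewrite Re_conjc.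
- rewrite -mulN1r -RintegralZl//; apply: eq_Rintegral => x _.
  by rewrite Im_conjc mulN1r.
Qed.

Lemma L2fun_cmeasurable f : L2fun mu f -> cmeasurable f.
Proof. by case. Qed.

Lemma L2fun_integrable f : L2fun mu f ->
  mu.-integrable setT (EFin \o (fun x => sqmod (f x))).
Proof.
move=> [f1 f2 fn]; apply/integrableP; split.
  by apply/measurable_EFinP; exact: measurable_sqmod.
by under eq_integral do rewrite /= ger0_norm ?sqmod_ge0//.
Qed.

Lemma L2funP f : cmeasurable f ->
  mu.-integrable setT (EFin \o (fun x => sqmod (f x))) -> L2fun mu f.
Proof.
move=> [f1 f2] /integrableP[_].
by under eq_integral do rewrite /= ger0_norm ?sqmod_ge0//; split.
Qed.

Lemma normsq_ge0 f : (0 <= normsq mu f)%E.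
Proof. by apply: integral_ge0 => x _; rewrite lee_fin sqmod_ge0. Qed.

Lemma normsq_fin_num f : L2fun mu f -> normsq mu f \is a fin_num.
Proof. by case=> _ _ fn; rewrite ge0_fin_numE ?normsq_ge0. Qed.

Lemma cintegrable_inner f g : L2fun mu f -> L2fun mu g ->
  cintegrable (fun x => f x * conjc (g x)).
Proof.
move=> lf lg; apply: (@cintegrable_le _ (fun x => sqmod (f x) + sqmod (g x))).
- by apply: cmeasurableM; [|apply: cmeasurable_conj]; exact: L2fun_cmeasurable.
- by apply: integrable_add; exact: L2fun_integrable.
- by move=> x; exact: ReM_conj_le.
- by move=> x; exact: ImM_conj_le.
Qed.

Lemma L2fun_lin (a b : R[i]) f g : L2fun mu f -> L2fun mu g ->
  L2fun mu (fun x => a * f x + b * g x).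
Proof.
move=> lf lg; have mf := L2fun_cmeasurable lf; have mg := L2fun_cmeasurable lg.
have mfg : cmeasurable (fun x => a * f x + b * g x).
  apply: cmeasurableD; apply: cmeasurableM => //; exact: cmeasurable_cst.
apply: L2funP => //.
have ib : mu.-integrable setT (EFin \o (fun x =>
    (2 * sqmod a) * sqmod (f x) + (2 * sqmod b) * sqmod (g x))).
  by apply: integrable_add; apply: integrable_scale; exact: L2fun_integrable.
apply: le_integrable ib => //.
  by apply/measurable_EFinP; exact: measurable_sqmod.
move=> x _ /=; rewrite lee_fin !ger0_norm ?sqmod_ge0//; last first.
  by rewrite addr_ge0 ?mulr_ge0 ?sqmod_ge0.
by rewrite -!mulrA -!sqmodM; exact: sqmodD_le.
Qed.

Lemma inner_lin (a b : R[i]) f g h : L2fun mu f -> L2fun mu g -> L2fun mu h ->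
  inner mu (fun x => a * f x + b * g x) h = a * inner mu f h + b * inner mu g h.
Proof.
move=> lf lg lh; rewrite /inner -!CintegralZl; [|exact: cintegrable_inner..].
rewrite -CintegralD; [|exact/cintegrableZ/cintegrable_inner..].
by congr Cintegral; apply/funext => x; rewrite mulrDl !mulrA.
Qed.

Lemma inner_conj f g : L2fun mu f -> L2fun mu g ->
  inner mu g f = conjc (inner mu f g).
Proof.
move=> lf lg; rewrite /inner -Cintegral_conj; last exact: cintegrable_inner.
by congr Cintegral; apply/funext => x; rewrite conjc_mul conjcK mulrC.
Qed.

Lemma inner_self f : L2fun mu f -> inner mu f f = (fine (normsq mu f))%:C.
Proof.
move=> lf; apply: complexP => /=.
  by apply: eq_Rintegral => x _; rewrite mul_conjc.
by rewrite /Rintegral; under eq_integral do rewrite mul_conjc /=;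
  rewrite integral0.
Qed.

End complex_integral.

(** * Bessel's inequality and orthonormal bases *)

Section bessel.
Context d (T : measurableType d) (R : realType).
Variable mu : {measure set T -> \bar R}.
Implicit Types (f g : T -> R[i]) (E : set (T -> R[i])).

(** Induction on the family: replacing g by g - <g, e> e lowers |g|^2 by
    |<g, e>|^2 and leaves the other coefficients unchanged. *)
Lemma bessel E g (s : seq (T -> R[i])) : E `<=` L2fun mu -> Defs.orthonormal mu E ->
  L2fun mu g -> {in s, forall e, E e} -> uniq s ->
  \sum_(e <- s) sqmod (inner mu g e) <= fine (normsq mu g).
Proof.
move=> EL [E1 E0]; elim: s g => [|e s IH] g lg sE us.
  by rewrite big_nil fine_ge0 ?normsq_ge0.
have Ee : E e by apply: sE; rewrite inE eqxx.
have le := EL _ Ee.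
move: us => /= /andP[es us].
set c := inner mu g e.
pose g' := (fun x => 1 * g x + (- c) * e x).
have lg' : L2fun mu g' by exact: L2fun_lin.
have g'e' h : L2fun mu h -> inner mu g' h = inner mu g h - c * inner mu e h.
  by move=> lh; rewrite inner_lin// mul1r mulNr.
have g'e : inner mu g' e = 0 by rewrite g'e'// E1// mulr1 subrr.
have g'g' : inner mu g' g' = inner mu g g - (sqmod c)%:C.
  rewrite g'e'// (inner_conj lg' le) g'e conjc0 mulr0 subr0.
  rewrite (inner_conj lg' lg) g'e'// (inner_conj lg le) -/c mul_conjc.
  by rewrite (inner_self lg); apply: complexP; rewrite !cE /= ?subrr ?oppr0.
have ng : fine (normsq mu g) = fine (normsq mu g') + sqmod c.
  move: g'g'; rewrite !inner_self// => /(congr1 (@complex.Re R)); rewrite !cE /=.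
  by move=> ->; rewrite subrK.
rewrite big_cons -/c ng addrC lerD2r.
rewrite (eq_big_seq (fun e' => sqmod (inner mu g' e'))); last first.
  move=> e' e's; rewrite g'e'; last by apply/EL/sE; rewrite inE e's orbT.
  rewrite (E0 e e')// ?mulr0 ?subr0//; first by apply: sE; rewrite inE e's orbT.
  by move=> ee'; move: es; rewrite ee' e's.
by apply: IH => // e' e's; apply: sE; rewrite inE e's orbT.
Qed.

Lemma bessel1 f g : L2fun mu f -> L2fun mu g -> inner mu f f = 1 ->
  sqmod (inner mu g f) <= fine (normsq mu g).
Proof.
move=> lf lg f1; have := @bessel [set f] g [:: f] _ _ lg _ isT.
rewrite big_seq1; apply.
- by move=> _ ->.
- by split => [_ -> //|_ _ -> ->].
- by move=> e; rewrite inE => /eqP.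
Qed.

Lemma normsq_eq0 f : L2fun mu f -> normsq mu f = 0%E ->
  {ae mu, forall x, f x = 0}.
Proof.
move=> lf nf0.
have mf : measurable_fun setT (EFin \o (fun x => sqmod (f x))).
  by apply/measurable_EFinP/measurable_sqmod/(L2fun_cmeasurable lf).
have /(ae_eq_integral_abs mu measurableT mf) : (\int[mu]_x
    `|(EFin \o (fun x => sqmod (f x))) x| = 0)%E.
  by under eq_integral do rewrite /= ger0_norm ?sqmod_ge0//.
apply: filterS => x /(_ I)/= [] /eqP.
rewrite /sqmod paddr_eq0 ?sqr_ge0// !sqrf_eq0 => /andP[/eqP a /eqP b].
exact: complexP.
Qed.

Lemma orthonormalU1 E g : Defs.orthonormal mu E -> E `<=` L2fun mu ->
  L2fun mu g -> inner mu g g = 1 -> (forall e, E e -> inner mu g e = 0) ->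
  Defs.orthonormal mu (g |` E).
Proof.
move=> [E1 E0] EL lg g1 gE; split; first by move=> e [->//|/E1].
move=> e e' [->|Ee] [->|Ee']//.
- by move=> _; exact: gE.
- by move=> _; rewrite (inner_conj lg (EL _ Ee)) gE// conjc0.
- exact: E0.
Qed.

(** Zorn's lemma, applied to the sets that stay orthonormal after f is added:
    a vector orthogonal to a maximal one is null, since otherwise it could be
    normalized and added. *)
Lemma exists_onb_mem f : L2fun mu f -> inner mu f f = 1 ->
  exists2 E, orthonormal_basis mu E & E f.
Proof.
move=> lf f1.
pose P (E : set (T -> R[i])) := f |` E `<=` L2fun mu /\ Defs.orthonormal mu (f |` E).
have [F FP totF|E [[EL oE] maxE]] := @Zorn_bigcup _ P.
  split.
    move=> e [->//|[X FX Xe]]; have [XL _] := FP _ FX; apply: XL; exact: or_intror.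
  split.
    move=> e [->//|[X FX Xe]]; have [_ [+ _]] := FP _ FX; apply; exact: or_intror.
  move=> e e' [->|[X FX Xe]] [->|[Y FY Ye']]//.
  - have [_ [_ +]] := FP _ FY; apply; [exact: or_introl|exact: or_intror].
  - have [_ [_ +]] := FP _ FX; apply; [exact: or_intror|exact: or_introl].
  - have [XY|YX] := totF _ _ FX FY.
      have [_ [_ +]] := FP _ FY; apply; right => //; exact: XY.
    by have [_ [_ +]] := FP _ FX; apply; right => //; exact: YX.
exists (f |` E); last exact: or_introl.
split => // g lg gE; apply: normsq_eq0 => //.
apply/eqP/negP => /negP ng0.
set N := fine (normsq mu g).
have N0 : 0 < N.
  by rewrite /N fine_gt0// lt0e ng0 normsq_ge0/= -ge0_fin_numE ?normsq_ge0//;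
    exact: normsq_fin_num.
pose c : R[i] := ((Num.sqrt N)^-1)%:C.
pose k : T -> R[i] := fun x => c * g x + 0 * g x.
have lk : L2fun mu k by exact: L2fun_lin.
have ke h : L2fun mu h -> inner mu k h = c * inner mu g h.
  by move=> lh; rewrite inner_lin// mul0r addr0.
have k1 : inner mu k k = 1.
  rewrite ke// (inner_conj lk lg) ke// inner_self// -/N.
  rewrite conjc_mul mulrA mul_conjc /sqmod /= expr0n /= addr0 exprVn.
  rewrite sqr_sqrtr ?ltW//; apply: complexP; rewrite !cE /= ?oppr0.
    by rewrite !mulr0 subr0 mulVf// gt_eqF.
  by rewrite mulr0 mul0r addr0.
have kE : forall e, (f |` E) e -> inner mu k e = 0.
  by move=> e fEe; rewrite ke ?gE ?mulr0//; exact: EL.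
have nEk : ~ E k.
  move=> Ek; have := kE k (or_intror Ek); rewrite k1 => /eqP.
  by rewrite oner_eq0.
apply: (maxE (k |` E)); first by split; [move=> e; exact: or_intror|
  move=> /(_ k) /= h; apply/nEk/h; exact: or_introl].
rewrite /P setUCA; split; last exact: orthonormalU1.
by move=> e [->//|]; exact: EL.
Qed.

End bessel.

(** * Lebesgue measure on tuples *)

Section tuple_measurability.
Context {R : realType} {n : nat}.
Context d (T : measurableType d).
Implicit Types f g : T -> Rn R n.

Lemma measurable_tuple_of (F : 'I_n -> T -> R) :
  (forall i, measurable_fun setT (F i)) ->
  measurable_fun setT (fun x => [tuple F i x | i < n] : Rn R n).
Proof.
move=> mF; apply/measurable_fun_tnthP => i.
by apply: (eq_measurable_fun (F i)) => // x _ /=; rewrite tnth_mktuple.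
Qed.

Lemma measurable_tnth_comp f i : measurable_fun setT f ->
  measurable_fun setT (fun x => tnth (f x) i : R).
Proof. by move=> /measurable_fun_tnthP /(_ i). Qed.

Lemma measurable_dot f g : measurable_fun setT f -> measurable_fun setT g ->
  measurable_fun setT (fun x => dot (f x) (g x)).
Proof.
move=> mf mg; apply: measurable_sum => i.
by apply: measurable_funM; exact: measurable_tnth_comp.
Qed.

Lemma measurable_tsub f g : measurable_fun setT f -> measurable_fun setT g ->
  measurable_fun setT (fun x => tsub (f x) (g x)).
Proof.
move=> mf mg; apply: measurable_tuple_of => i.
by apply: measurable_funB; exact: measurable_tnth_comp.
Qed.

End tuple_measurability.

Section lebesgue_tuple.
Context {R : realType}.
Local Notation mu1 := (@lebesgue_measure R).
Local Open Scope ereal_scope.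

Definition tscale n (s : R) (y : Rn R n) : Rn R n :=
  [tuple (s * tnth y i)%R | i < n].

Lemma ge0_integral_lebesgue0 (F : Rn R 0 -> \bar R) :
  measurable_fun setT F -> (forall y, 0 <= F y) ->
  \int[lebesgue R 0]_y F y = F [tuple].
Proof.
move=> mF F0; rewrite /lebesgue /= integral_dirac//.
by rewrite diracT mul1e.
Qed.

(** Lebesgue measure on R^(n+1) is the image of a product measure, so Tonelli's
    theorem splits off the first coordinate; this drives every induction on the
    dimension below. *)
Lemma ge0_integral_lebesgueS n (F : Rn R n.+1 -> \bar R) :
  measurable_fun setT F -> (forall y, 0 <= F y) ->
  \int[lebesgue R n.+1]_y F y =
  \int[mu1]_x \int[lebesgue R n]_y F [tuple of x :: y].
Proof.
move=> mF F0; rewrite /lebesgue /=.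
rewrite [LHS](ge0_integral_pushforward (@measurable_tcons _ (measurableTypeR R) n))//.
rewrite preimage_setT (fubini_tonelli1 (F \o @tcons _ (measurableTypeR R) n))//.
by apply: measurableT_comp => //; exact: measurable_tcons.
by move=> ?; exact: F0.
Qed.

Lemma dot_cons n (x x' : R) (y y' : Rn R n) :
  dot ([tuple of x :: y] : Rn R n.+1) [tuple of x' :: y'] =
  (x * x' + dot y y')%R.
Proof.
rewrite /dot big_ord_recl !tnth0; congr (_ + _)%R.
by apply: eq_bigr => i _; rewrite !tnthS.
Qed.

Lemma tsub_cons n (x x' : R) (y y' : Rn R n) :
  tsub ([tuple of x :: y] : Rn R n.+1) [tuple of x' :: y'] =
  [tuple of (x - x')%R :: tsub y y'].
Proof.
apply: eq_from_tnth => i; rewrite tnth_mktuple.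
by case: (unliftP 0%R i) => [j|] ->; rewrite ?tnthS ?tnth0 ?tnth_mktuple.
Qed.

Lemma tscale_cons n (s x : R) (y : Rn R n) :
  tscale s ([tuple of x :: y] : Rn R n.+1) =
  [tuple of (s * x)%R :: tscale s y].
Proof.
apply: eq_from_tnth => i; rewrite tnth_mktuple.
by case: (unliftP 0%R i) => [j|] ->; rewrite ?tnthS ?tnth0 ?tnth_mktuple.
Qed.

Lemma measurable_tscale n (s : R) : measurable_fun setT (@tscale n s).
Proof.
apply: measurable_tuple_of => i; apply: measurable_funM => //.
exact: measurable_tnth_comp.
Qed.

(** The integrand is, up to its normalization, the density of the normal law with
    mean m and variance 1/(2a). *)
Lemma integral_gauss1 (a m : R) : (0 < a)%R ->
  \int[mu1]_x (expR (- (a * ((x - m) * (x - m)))))%:E = (Num.sqrt (pi / a))%:E.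
Proof.
move=> a0; pose s := Num.sqrt ((2 * a)^-1).
have s2 : (s ^+ 2 = (2 * a)^-1)%R.
  by rewrite sqr_sqrtr// invr_ge0 mulr_ge0// ltW.
have s0 : s != 0%R by rewrite gt_eqF// sqrtr_gt0 invr_gt0 mulr_gt0.
have peak : normal_peak s = (Num.sqrt (pi / a))^-1%R.
  congr ((Num.sqrt _)^-1)%R; rewrite s2 -mulr_natr; field.
  by rewrite gt_eqF.
have := @integral_normal_pdf R m s.
under eq_integral => x _.
  rewrite normal_pdfE// peak /normal_fun s2.
  rewrite (_ : - (x - m) ^+ 2 / _ = - (a * ((x - m) * (x - m))))%R; last first.
    by rewrite -mulr_natr; field; rewrite gt_eqF.
  over.
rewrite /= => h.
have p0 : (0 < Num.sqrt (pi / a))%R by rewrite sqrtr_gt0 divr_gt0// pi_gt0.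
under eq_integral do rewrite -(mul1r (expR _)) -(mulfV (lt0r_neq0 p0)) -mulrA EFinM.
rewrite ge0_integralZl_EFin//.
- by move: h => /= h; rewrite [X in _ * X](_ : _ = 1) ?mule1//; exact: h.
- apply/measurable_EFinP; apply: measurable_funM => //.
  apply: measurableT_comp => //; apply: measurableT_comp => //.
  by apply: measurable_funM => //; apply: measurable_funM; exact: measurable_funB.
Qed.

Lemma measurable_gaussn n (a : R) (m : Rn R n) : measurable_fun setT
  (fun y => (expR (- (a * dot (tsub y m) (tsub y m))))%:E).
Proof.
apply/measurable_EFinP; apply: measurableT_comp => //.
apply: measurableT_comp => //; apply: measurable_funM => //.
by apply: measurable_dot; exact: measurable_tsub.
Qed.

Lemma integral_gaussn n (a : R) (m : Rn R n) : (0 < a)%R ->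
  \int[lebesgue R n]_y (expR (- (a * dot (tsub y m) (tsub y m))))%:E =
  (Num.sqrt (pi / a) ^+ n)%:E.
Proof.
move=> a0; elim: n m => [|n IH] m.
  rewrite ge0_integral_lebesgue0//.
  - by rewrite /dot big_ord0 mulr0 oppr0 expR0 expr0.
  - exact: measurable_gaussn.
rewrite ge0_integral_lebesgueS//; last exact: measurable_gaussn.
case/tupleP: m => m0 m.
under eq_integral => x _.
  under eq_integral => y _.
    rewrite tsub_cons dot_cons mulrDr opprD expRD EFinM; over.
  rewrite ge0_integralZl_EFin//; last exact: measurable_gaussn.
  rewrite IH muleC; over.
rewrite ge0_integralZl_EFin//.
- by rewrite integral_gauss1// exprSr EFinM.
- by apply/measurable_EFinP; apply: measurableT_comp => //;
    apply: measurableT_comp => //; apply: measurable_funM => //;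
    apply: measurable_funM; exact: measurable_funB.
Qed.

Definition tbox n (a b : Rn R n) : set (Rn R n) :=
  [set y | forall i, (tnth a i <= tnth y i <= tnth b i)%R].

Lemma measurable_tbox n (a b : Rn R n) : measurable (tbox a b).
Proof.
have -> : tbox a b = \bigcap_(i in [set: 'I_n])
    ((fun y : Rn R n => tnth y i : R) @^-1` `[tnth a i, tnth b i]%classic).
  apply/seteqP; split => [y ab i _|y ab i] /=; rewrite ?in_itv/=; first exact: ab.
  by have := ab i I; rewrite /= in_itv.
apply: fin_bigcap_measurable => // i _.
rewrite -[X in measurable X]setTI.
apply: (@measurable_tnth _ (measurableTypeR R) n i) => //.
Qed.

Lemma lebesgue_tbox n (a b : Rn R n) (s : R) : (0 <= s)%R ->
  (forall i, tnth b i - tnth a i = s)%R ->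
  lebesgue R n (tbox a b) = (s ^+ n)%:E.
Proof.
move=> s0; elim: n a b => [|n IH] a b ab.
  by rewrite /lebesgue /= diracE expr0 mem_set// => -[].
case/tupleP: a ab => a0 a; case/tupleP: b => b0 b ab.
have ab0 := ab ord0; rewrite !tnth0 in ab0.
rewrite /lebesgue /= /cons_measure /pushforward.
rewrite (_ : _ @^-1` _ = `[a0, b0]%classic `*` tbox a b); last first.
  apply/seteqP; split => [[x y] xy|[x y] [/= + xy] i] /=.
    split; first by have := xy ord0; rewrite !tnth0 in_itv.
    by move=> i; have := xy (lift ord0 i); rewrite !tnthS.
  rewrite in_itv /= => x0; case: (unliftP 0%R i) => [j|] ->.
    by rewrite !tnthS; exact: xy.
  by rewrite !tnth0.
rewrite product_measure1E//; last exact: measurable_tbox.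
rewrite -/(lebesgue R n) IH; last first.
  by move=> i; have := ab (lift ord0 i); rewrite !tnthS.
rewrite [X in X * _](_ : _ = s%:E) ?exprS ?EFinM//.
rewrite /= lebesgue_measure_itv/= lte_fin -subr_gt0 ab0.
by case: ltP => [|s0']; [rewrite -EFinB ab0|apply/eqP; rewrite eqe eq_le s0].
Qed.

(** The image of Lebesgue measure under multiplication by s, times s, agrees with
    Lebesgue measure on intervals. *)
Lemma ge0_integral_scale1 (s : R) (F : R -> \bar R) : (0 < s)%R ->
  measurable_fun [set: R] F -> (forall y, 0 <= F y) ->
  s%:E * \int[mu1]_x F (s * x)%R = \int[mu1]_x F x.
Proof.
move=> s0 mF F0.
have ms : measurable_fun [set: measurableTypeR R]
    (fun x => (s * x)%R : measurableTypeR R) by exact: measurable_funM.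
have S : (0 <= s)%R by exact: ltW.
rewrite -[X in _ * X]/(\int[mu1]_(x in
  (fun x => (s * x)%R : measurableTypeR R) @^-1` setT)
  (F \o (fun x => (s * x)%R : measurableTypeR R)) x).
rewrite -ge0_integral_pushforward//.
rewrite -[s]/(NngNum S)%:num -ge0_integral_mscale//.
apply: eq_measure_integral => A mA _.
apply/esym/lebesgue_measure_unique => // _ [[a b] _ <-].
rewrite /= /mscale /pushforward /=.
rewrite [X in _ * X](_ : _ = mu1 `](a / s)%R, (b / s)%R]%classic); last first.
  rewrite [LHS]/(mu1 (_ @^-1` _)); congr mu1.
  by apply/seteqP; split => x /=;
    rewrite !in_itv/= ltr_pdivrMr// ler_pdivlMr// mulrC.
rewrite !lebesgue_measure_itv/= !lte_fin ltr_pM2r ?invr_gt0//.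
case: ltP => _; last by rewrite mule0.
by rewrite -!EFinB -EFinM -mulrBl mulrC divfK// gt_eqF.
Qed.

Lemma ge0_integral_tscale n (s : R) (F : Rn R n -> \bar R) : (0 < s)%R ->
  measurable_fun setT F -> (forall y, 0 <= F y) ->
  (s ^+ n)%:E * \int[lebesgue R n]_y F (tscale s y) =
  \int[lebesgue R n]_y F y.
Proof.
move=> s0; elim: n F => [|n IH] F mF F0.
  rewrite expr0 mul1e; apply: eq_integral => y _.
  by rewrite (tuple0 (tscale s y)) (tuple0 y).
have mFs : measurable_fun setT (F \o tscale s).
  by apply: measurableT_comp => //; exact: measurable_tscale.
have mFc : measurable_fun setT (F \o @tcons _ (measurableTypeR R) n).
  by apply: measurableT_comp => //; exact: measurable_tcons.
rewrite !ge0_integral_lebesgueS//.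
rewrite -(@ge0_integral_scale1 s (fun x =>
  \int[lebesgue R n]_y F [tuple of x :: y]))//; last 2 first.
- by apply: (measurable_fun_fubini_tonelli_F _ mFc) => y; exact: F0.
- by move=> y; exact: integral_ge0.
rewrite exprS EFinM -muleA; congr (_ * _).
rewrite -ge0_integralZl_EFin//; last 3 first.
- by move=> x _; exact: integral_ge0.
- apply: (measurable_fun_fubini_tonelli_F
    (F \o tscale s \o @tcons _ (measurableTypeR R) n)) => //.
    by apply: measurableT_comp => //; exact: measurable_tcons.
  by move=> z; exact: F0.
- by rewrite exprn_ge0// ltW.
apply: eq_integral => x _.
rewrite -(IH (fun y => F [tuple of (s * x)%R :: y]))//; last first.
  by apply: measurableT_comp => //; exact: measurable_cons.
congr (_ * _); apply: eq_integral => y _.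
by rewrite tscale_cons.
Qed.

Lemma lebesgue2_integral d (F : Rn R d * Rn R d -> \bar R) :
  measurable_fun setT F -> (forall z, 0 <= F z) ->
  \int[lebesgue2 R d]_z F z =
  \int[lebesgue R d]_x \int[lebesgue R d]_y F (x, y).
Proof. by move=> mF F0; rewrite -fubini_tonelli1. Qed.

End lebesgue_tuple.

(** * The short-time Fourier transform with Gaussian window *)

(** The integrals of the positive and of the negative part are measurable in the
    parameter by Tonelli's theorem. *)
Lemma measurable_Rintegral_param d1 d2 (T1 : measurableType d1)
    (T2 : measurableType d2) (R : realType)
    (m2 : {sigma_finite_measure set T2 -> \bar R}) (k : T1 * T2 -> R) :
  measurable_fun setT k ->
  measurable_fun setT (fun x => \int[m2]_y k (x, y)).
Proof.
move=> mk.
have mk' : measurable_fun setT (EFin \o k) by exact/measurable_EFinP.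
apply: measurableT_comp => //=.
rewrite (_ : (fun x => _) = (fun x => \int[m2]_y ((EFin \o k)^\+ (x, y)) -
   \int[m2]_y ((EFin \o k)^\- (x, y)))%E); last first.
  apply/funext => x; rewrite integralE.
  by congr (_ - _)%E; apply: eq_integral => y _; rewrite ?funeposE ?funenegE.

apply: emeasurable_funB.
- by apply: (measurable_fun_fubini_tonelli_F (EFin \o k)^\+%E) ;
    [exact: measurable_funepos|exact: funepos_ge0].
- by apply: (measurable_fun_fubini_tonelli_F (EFin \o k)^\-%E) ;
    [exact: measurable_funeneg|exact: funeneg_ge0].
Qed.

Section atoms.
Context {R : realType} {d : nat}.
Local Notation X := (Rn R d).
Local Notation Z := (Rn R d * Rn R d)%type.
Local Notation mu := (lebesgue R d).
Local Notation mu2 := (lebesgue2 R d).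
Implicit Types (x y : X) (z : Z) (f g : X -> R[i]).

(** The time-frequency shift by z of the Gaussian window. *)
Definition atom z y : R[i] :=
  (gaussian (tsub y z.1))%:C * expi (2 * pi * dot z.2 y).

Lemma sqmod_expi (t : R) : sqmod (expi t) = 1.
Proof. by rewrite /sqmod /= cos2Dsin2. Qed.

Lemma sqmod_real (a : R) : sqmod a%:C = a ^+ 2.
Proof. by rewrite /sqmod /= expr0n /= addr0. Qed.

(** The transform collects the coefficients of f along the atoms. *)
Lemma stftE f z : stft f z = inner mu f (atom z).
Proof.
rewrite /stft /inner; congr Cintegral; apply/funext => y.
rewrite /atom conjc_mul mulrA; congr (_ * _).
by rewrite /expi !mulNr cosN sinN.
Qed.

Lemma gaussian_ge0 x : 0 <= gaussian x.
Proof. by rewrite mulr_ge0 ?powR_ge0 ?expR_ge0. Qed.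

Definition gauss_cst : R := 2 `^ (d%:R / 4).

(** The factor 2^(d/4) is what makes the Gaussian a unit vector. *)
Lemma gauss_cst_norm : gauss_cst ^+ 2 * Num.sqrt (pi / (2 * pi)) ^+ d = 1.
Proof.
have -> : pi / (2 * pi) = 2^-1 :> R.
  by rewrite invfM mulrCA divff ?mulr1// gt_eqF// pi_gt0.
apply/eqP; rewrite -(@eqrXn2 _ 2)// ?expr1n; last first.
  by rewrite mulr_ge0// ?sqr_ge0// exprn_ge0.
rewrite exprMn -!exprM (mulnC d) (exprM _ 2 d) sqr_sqrtr ?invr_ge0//.
rewrite -powR_mulrn ?powR_ge0// -powRrM divfK ?pnatr_eq0//.
by rewrite powR_mulrn// exprVn mulfV// expf_neq0.
Qed.

Lemma gauss_cst_gt0 : 0 < gauss_cst. Proof. exact: powR_gt0. Qed.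

Lemma gaussian_sq x :
  gaussian x ^+ 2 = gauss_cst ^+ 2 * expR (- (2 * pi * dot x x)).
Proof.
by rewrite /gaussian exprMn -expRM_natl; congr (_ * expR _); ring.
Qed.

Lemma measurable_gaussian d' (T : measurableType d') (u : T -> X) :
  measurable_fun setT u -> measurable_fun setT (fun t => gaussian (u t)).
Proof.
move=> mf; apply: measurable_funM => //; apply: measurableT_comp => //.
by apply: measurable_funM => //; exact: measurable_dot.
Qed.

Lemma cmeasurable_atom d' (T : measurableType d') (u : T -> Z) (v : T -> X) :
  measurable_fun setT u -> measurable_fun setT v ->
  cmeasurable (fun t => atom (u t) (v t)).
Proof.
move=> mf mv; have m1 : measurable_fun setT (fun t => (u t).1).
  exact: measurableT_comp.
have m2 : measurable_fun setT (fun t => (u t).2) by exact: measurableT_comp.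
apply: cmeasurableM.
  by apply: cmeasurable_real; apply: measurable_gaussian; exact: measurable_tsub.
have mt : measurable_fun setT (fun t => 2 * pi * dot (u t).2 (v t)).
  by apply: measurable_funM => //; exact: measurable_dot.
split => /=.
  by apply: measurableT_comp mt => //;
    exact: (continuous_measurable_fun (@continuous_cos R)).
by apply: measurableT_comp mt => //;
    exact: (continuous_measurable_fun (@continuous_sin R)).
Qed.

Lemma sqmod_atom z y : sqmod (atom z y) =
  gauss_cst ^+ 2 * expR (- (2 * pi * dot (tsub y z.1) (tsub y z.1))).
Proof. by rewrite /atom sqmodM sqmod_expi mulr1 sqmod_real gaussian_sq. Qed.

Lemma normsq_atom z : normsq mu (atom z) = 1%E.
Proof.
have pi0 : 0 < 2 * pi :> R by rewrite mulr_gt0// pi_gt0.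
rewrite /normsq; under eq_integral do rewrite -/(sqmod _) sqmod_atom EFinM.
rewrite ge0_integralZl_EFin ?sqr_ge0//; last exact: measurable_gaussn.
by rewrite integral_gaussn// -EFinM gauss_cst_norm.
Qed.

Lemma L2fun_atom z : L2fun mu (atom z).
Proof.
have [m1 m2] : cmeasurable (atom z).
  by apply: (@cmeasurable_atom _ X (fun=> z) id).
by split => //; rewrite normsq_atom ltry.
Qed.

Lemma inner_atom z : inner mu (atom z) (atom z) = 1.
Proof. by rewrite inner_self ?normsq_atom//; exact: L2fun_atom. Qed.

Lemma sqmod_stft_le f z : L2fun mu f -> sqmod (stft f z) <= fine (normsq mu f).
Proof.
by move=> lf; rewrite stftE; apply: bessel1 => //;
  [exact: L2fun_atom|exact: inner_atom].
Qed.

Lemma cmeasurable_stft f : L2fun mu f -> cmeasurable (stft f).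
Proof.
move=> lf.
have m : cmeasurable (fun p : Z * X => f p.2 * conjc (atom p.1 p.2)).
  apply: cmeasurableM; last first.
    by apply/cmeasurable_conj/cmeasurable_atom.
  have [f1 f2] := L2fun_cmeasurable lf.
  by split; apply: (@measurableT_comp _ _ _ _ _ _ (fun y => _ (f y))).
have -> : stft f = fun z => inner mu f (atom z).
  by apply/funext => z; rewrite stftE.
split.
- exact: (measurable_Rintegral_param mu m.1).
- exact: (measurable_Rintegral_param mu m.2).
Qed.

End atoms.

(** * The upper bound for Hilbert-Schmidt norms *)

Section bounded_on_finite_measure.
Context d (T : measurableType d) (R : realType).
Variable mu : {measure set T -> \bar R}.
Variables (Omega : set T) (mO : measurable Omega) (fO : (mu Omega < +oo)%E).
Local Notation chi := (\1_Omega : T -> R).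

Lemma integrable_indic_fin : mu.-integrable setT (EFin \o chi).
Proof.
apply/integrableP; split.
  by apply/measurable_EFinP; exact: measurable_indic.
under eq_integral do rewrite /= ger0_norm//.
by rewrite integral_indic// setIT.
Qed.

Lemma Rintegral_indic : \int[mu]_x chi x = fine (mu Omega).
Proof. by rewrite /Rintegral integral_indic// setIT. Qed.

Lemma integrable_indicM (u : T -> R) (c : R) : measurable_fun setT u ->
  (forall x, Omega x -> `|u x| <= c) ->
  mu.-integrable setT (EFin \o (fun x => chi x * u x)).
Proof.
move=> mu' uc.
have := integrable_scale c integrable_indic_fin; apply: le_integrable => //.
  by apply/measurable_EFinP; apply: measurable_funM => //; exact: measurable_indic.
move=> x _ /=; rewrite lee_fin !normrM mulrC.
have [xO|xO] := boolP (x \in Omega).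
  rewrite indicE xO ler_wpM2r// (le_trans (uc _ _) (ler_norm _))//.
  exact: set_mem.
by rewrite indicE (negbTE xO) normr0 !mulr0.
Qed.

Lemma cintegrable_indicM (f : T -> R[i]) (c : R) : cmeasurable f ->
  (forall x, Omega x -> sqmod (f x) <= c) ->
  cintegrable mu (fun x => (chi x)%:C * f x).
Proof.
move=> [f1 f2] fc.
have sq_le (a b : R) x : Omega x -> a ^+ 2 + b ^+ 2 <= c -> `|a| <= c + 1.
  move=> _ abc; rewrite ler_norml; apply/andP.
  have := (sqr_ge0 (a - 1), sqr_ge0 (a + 1), sqr_ge0 b, sqr_ge0 a).
  by rewrite sqrrB sqrrD => -[[[]]] h1 h2 h3 h4; split; lra.
split.
- under [X in EFin \o X]eq_fun do rewrite Re_realM.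
  apply: (@integrable_indicM _ (c + 1)) => // x Ox.
  exact: sq_le Ox (fc _ Ox).
- under [X in EFin \o X]eq_fun do rewrite Im_realM.
  apply: (@integrable_indicM _ (c + 1)) => // x Ox.
  by apply: (sq_le _ (Re (f x)) x Ox); rewrite addrC; exact: fc.
Qed.

End bounded_on_finite_measure.

Section hs_upper_bound.
Context {R : realType} {d : nat}.
Local Notation X := (Rn R d).
Local Notation Z := (Rn R d * Rn R d)%type.
Local Notation mu := (lebesgue R d).
Local Notation mu2 := (lebesgue2 R d).
Implicit Types (x y : X) (z : Z) (f g : X -> R[i]).
Variables (Omega : set Z) (mO : measurable Omega).
Variables (t : R) (t0 : 0 < t) (Ot : (mu2 Omega <= t%:E)%E).
Local Notation chi := (\1_Omega : Z -> R).

Let fO : (mu2 Omega < +oo)%E.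
Proof. by rewrite (le_lt_trans Ot)// ltry. Qed.

(** Let h = L f.  Then |h|^2 = int_Omega Re (V f conj (V h)), and the pointwise
    inequality 2 Re (a conj b) <= t |a|^2 + |b|^2 / t together with
    |V h|^2 <= |h|^2 and |Omega| <= t leaves
    |h|^2 <= t/2 int_Omega |V f|^2 + |h|^2 / 2. *)
Lemma normsq_locop_le f : L2fun mu f ->
  (normsq mu (locop Omega f) <=
   t%:E * \int[mu2]_z (chi z * sqmod (stft f z))%:E)%E.
Proof.
move=> lf.
have mf := cmeasurable_stft lf.
have ichi u c := @integrable_indicM _ _ _ mu2 _ mO fO u c.
have iI : mu2.-integrable setT (EFin \o (fun z => chi z * sqmod (stft f z))).
  apply: (ichi _ (fine (normsq mu f))); first exact: measurable_sqmod.
  by move=> z _; rewrite ger0_norm ?sqmod_ge0//; exact: sqmod_stft_le.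
have I0 : (0 <= \int[mu2]_z (chi z * sqmod (stft f z))%:E)%E.
  by apply: integral_ge0 => z _; rewrite lee_fin mulr_ge0// sqmod_ge0.
rewrite /locop /hadjoint; case: xgetP => [h _ [lh hadj]|_]; last first.
  rewrite (_ : normsq mu (fun=> 0) = 0%E).
    by apply: mule_ge0 => //; rewrite lee_fin ltW.
  rewrite /normsq (eq_integral (cst 0%E)) ?integral0//.
  by move=> x _ /=; rewrite expr0n /= addr0.
have mh := cmeasurable_stft lh.
set N := fine (normsq mu h).
pose I := \int[mu2]_z (chi z * sqmod (stft f z)).
have IE : (\int[mu2]_z (chi z * sqmod (stft f z))%:E)%E = I%:E.
  by rewrite /I /Rintegral fineK//; exact: (integrable_fin_num _ iI).
rewrite IE -(fineK (normsq_fin_num lh)) -/N -EFinM lee_fin.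
have N0 : 0 <= N by rewrite fine_ge0 ?normsq_ge0.
have NE : N = \int[mu2]_z Re ((chi z)%:C * stft f z * conjc (stft h z)).
  have := inner_self lh; rewrite (hadj _ lh) => /(congr1 (@complex.Re R)) /= NE.
  by rewrite /N -NE.
have pt (a b : R[i]) : sqmod b <= N ->
    `|Re (a * conjc b)| <= t / 2 * sqmod a + N / (2 * t).
  move=> bN; have t2 : 0 < 2 * t by rewrite mulr_gt0.
  have -> : t / 2 * sqmod a + N / (2 * t) = (t ^+ 2 * sqmod a + N) / (2 * t).
    by field; rewrite gt_eqF.
  rewrite ler_pdivlMr//.
  rewrite -[X in _ * X]gtr0_norm// -normrM ler_norml.
  move: bN; rewrite !cE /sqmod; case: a b => [a1 a2] [b1 b2] /= bN.
  have := (sqr_ge0 (t * a1 - b1), sqr_ge0 (t * a1 + b1),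
           sqr_ge0 (t * a2 - b2), sqr_ge0 (t * a2 + b2)).
  rewrite !sqrrB !sqrrD !exprMn => -[[[]]] h1 h2 h3 h4.
  by apply/andP; split; lra.
have chiRe a b z : Re ((chi z)%:C * a * conjc b) = chi z * Re (a * conjc b).
  by rewrite -mulrA Re_realM.
have leN : N <= \int[mu2]_z (t / 2 * (chi z * sqmod (stft f z)) +
                             N / (2 * t) * chi z).
  rewrite {1}NE; apply: le_Rintegral => //.
  - under [X in EFin \o X]eq_fun do rewrite chiRe.
    apply: (ichi _ (t / 2 * fine (normsq mu f) + N / (2 * t))).
      exact: (cmeasurableM mf (cmeasurable_conj mh)).1.
    move=> z _; rewrite (le_trans (pt _ _ (sqmod_stft_le _ lh)))// lerD2r.
    by rewrite ler_wpM2l ?sqmod_stft_le// divr_ge0// ltW.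
  - apply: integrable_add; first exact: integrable_scale.
    exact/integrable_scale/integrable_indic_fin.
  - move=> z _; rewrite chiRe mulrCA [X in _ + X]mulrC -mulrDr ler_wpM2l//.
    exact: le_trans (ler_norm _) (pt _ _ (sqmod_stft_le _ lh)).
have := leN; rewrite RintegralD//; last 2 first.
- exact: integrable_scale.
- exact/integrable_scale/integrable_indic_fin.
rewrite !RintegralZl//; last exact: integrable_indic_fin.
rewrite -/I Rintegral_indic//.
have mt : fine (mu2 Omega) <= t.
  by rewrite -lee_fin fineK// ge0_fin_numE.
move=> le1; have le2 : N / (2 * t) * fine (mu2 Omega) <= N / 2.
  have -> : N / 2 = N / (2 * t) * t by field; rewrite gt_eqF.
  by rewrite ler_wpM2l// divr_ge0// mulr_ge0// ltW.
by lra.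
Qed.

(** After exchanging the finite sum with the integral over Omega, the integrand is
    the sum of the |<phi_z, e>|^2, at most |phi_z|^2 = 1. *)
Lemma hsnormsq_locop_le : (hsnormsq mu (locop Omega) <= (t ^+ 2)%:E)%E.
Proof.
apply: ge_ereal_sup => _ [E [EL oE _] <-].
apply: ge_ereal_sup => _ [F [finF FE] <-].
rewrite fsbig_finite//=; set s := finmap.enum_fset _.
have us : uniq s by exact: finmap.fset_uniq.
have sE : {in s, forall e, E e}.
  by move=> e es; apply: FE; move: es; rewrite in_fset_set// inE.
have sL e : e \in s -> L2fun mu e by move=> /sE /EL.
(* Outside s the transform of e need not be measurable, hence the cut-off. *)
pose u (e : X -> R[i]) z := if e \in s then sqmod (stft e z) else 0.
have mu' e : measurable_fun setT (u e).
  rewrite /u; have [es|_] := boolP (e \in s); last exact: measurable_cst.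
  exact/measurable_sqmod/cmeasurable_stft/sL.
have u0 e z : 0 <= u e z by rewrite /u; case: ifP; rewrite ?sqmod_ge0.
apply: (@le_trans _ _ (\sum_(e <- s) t%:E * \int[mu2]_z (chi z * u e z)%:E)%E).
  rewrite big_seq [leRHS]big_seq; apply: lee_sum => e es.
  rewrite (_ : (fun z => (chi z * u e z)%:E) =
               (fun z => (chi z * sqmod (stft e z))%:E)).
    exact: normsq_locop_le (sL _ es).
  by apply/funext => z; rewrite /u es.
rewrite -ge0_sume_distrr; last first.
  by move=> e _; apply: integral_ge0 => z _; rewrite lee_fin mulr_ge0.
rewrite expr2 EFinM lee_pmul2l ?lte_fin//; rewrite ?fin_numE//.
rewrite -ge0_integral_sum//; last 2 first.
- move=> e; apply/measurable_EFinP.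
  by apply: measurable_funM; [exact: measurable_indic|exact: mu'].
- by move=> e z _; rewrite lee_fin mulr_ge0.
apply: le_trans Ot; rewrite -[leRHS](_ : \int[mu2]_z (chi z)%:E = _)%E; last first.
  by rewrite integral_indic// setIT.
apply: ge0_le_integral => //.
- by move=> z _; apply: sume_ge0 => e _; rewrite lee_fin mulr_ge0.
- apply: emeasurable_sum => e; apply/measurable_EFinP.
  by apply: measurable_funM; [exact: measurable_indic|exact: mu'].
- by apply/measurable_EFinP; exact: measurable_indic.
move=> z _; rewrite sumEFin lee_fin -mulr_sumr ler_piMr//.
rewrite (eq_big_seq (fun e => sqmod (inner mu (atom z) e))); last first.
  move=> e es; rewrite /u es stftE (inner_conj (L2fun_atom z) (sL _ es)).
  exact: sqmod_conj.
have := bessel EL oE (L2fun_atom z) sE us.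
by rewrite normsq_atom.
Qed.

End hs_upper_bound.

(** * Fubini's theorem for complex integrands *)

Section product_sigma_finite.
Context d1 d2 (T1 : measurableType d1) (T2 : measurableType d2) (R : realType).
Variables (m1 : {sigma_finite_measure set T1 -> \bar R})
          (m2 : {sigma_finite_measure set T2 -> \bar R}).

Lemma sigma_finite_product : sigma_finite setT (m1 \x m2)%E.
Proof.
have /sigma_finiteP[F [FT ndF mF]] := sigma_finiteT m1.
have /sigma_finiteP[G [GT ndG mG]] := sigma_finiteT m2.
exists (fun k => F k `*` G k) => [|k].
  apply/seteqP; split=> // -[x y] _.
  have [i _ Fx] : (\bigcup_i F i) x by rewrite -FT.
  have [j _ Gy] : (\bigcup_j G j) y by rewrite -GT.
  exists (maxn i j) => //; split.
    by move: x Fx; exact/subsetPset/ndF/leq_maxl.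
  by move: y Gy; exact/subsetPset/ndG/leq_maxr.
have [mFk Fk] := mF k; have [mGk Gk] := mG k; split; first exact: measurableX.
by rewrite product_measure1E// lte_mul_pinfty// ge0_fin_numE.
Qed.

(** Fubini's theorem takes its two measures bundled with sigma-finiteness; this
    is the product measure in that form. *)
Definition product_sigma_finite_measure :
    {sigma_finite_measure set (T1 * T2)%type -> \bar R} :=
  HB.pack_for {sigma_finite_measure set (T1 * T2)%type -> \bar R}
    (m1 \x m2)%E
    (Measure_isSigmaFinite.Build _ _ _ (m1 \x m2)%E sigma_finite_product).

End product_sigma_finite.

Section fubini_complex.
Context d1 d2 (T1 : measurableType d1) (T2 : measurableType d2) (R : realType).
Variables (m1 : {sigma_finite_measure set T1 -> \bar R})
          (m2 : {sigma_finite_measure set T2 -> \bar R}).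
Local Notation m12 := (m1 \x m2)%E.

(** Integrability of each section makes the real-valued inner integrals agree
    everywhere with the extended ones. *)
Lemma Rintegral_fubini (k : T1 * T2 -> R) :
  m12.-integrable setT (EFin \o k) ->
  (forall x, m2.-integrable setT (EFin \o (fun y => k (x, y)))) ->
  (forall y, m1.-integrable setT (EFin \o (fun x => k (x, y)))) ->
  \int[m1]_x (\int[m2]_y k (x, y)) = \int[m2]_y (\int[m1]_x k (x, y)).
Proof.
move=> ik ik1 ik2; rewrite /Rintegral; congr fine.
have E1 x : (fine (\int[m2]_y (k (x, y))%:E))%:E = (\int[m2]_y (k (x, y))%:E)%E.
  by rewrite fineK//; exact: (integrable_fin_num _ (ik1 x)).
have E2 y : (fine (\int[m1]_x (k (x, y))%:E))%:E = (\int[m1]_x (k (x, y))%:E)%E.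
  by rewrite fineK//; exact: (integrable_fin_num _ (ik2 y)).
under eq_integral do rewrite E1.
under [RHS]eq_integral do rewrite E2.
exact: (Fubini ik).
Qed.

Lemma Cintegral_fubini (K : T1 * T2 -> R[i]) : cintegrable m12 K ->
  (forall x, cintegrable m2 (fun y => K (x, y))) ->
  (forall y, cintegrable m1 (fun x => K (x, y))) ->
  Cintegral m1 setT (fun x => Cintegral m2 setT (fun y => K (x, y))) =
  Cintegral m2 setT (fun y => Cintegral m1 setT (fun x => K (x, y))).
Proof.
move=> [K1 K2] Kx Ky; apply: complexP => /=.
- apply: (Rintegral_fubini K1) => [x|y]; [exact: (Kx x).1|exact: (Ky y).1].
- apply: (Rintegral_fubini K2) => [x|y]; [exact: (Kx x).2|exact: (Ky y).2].
Qed.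

Lemma integrable_tensor (w : T1 -> R) (v : T2 -> R) :
  m1.-integrable setT (EFin \o w) -> m2.-integrable setT (EFin \o v) ->
  (forall x, 0 <= w x) -> (forall y, 0 <= v y) ->
  m12.-integrable setT (EFin \o (fun p => w p.1 * v p.2)).
Proof.
move=> iw iv w0 v0.
have mw : measurable_fun setT w by apply/measurable_EFinP; exact: measurable_int iw.
have mv : measurable_fun setT v by apply/measurable_EFinP; exact: measurable_int iv.
have mwv : measurable_fun setT (EFin \o (fun p : T1 * T2 => w p.1 * v p.2)).
  apply/measurable_EFinP; apply: measurable_funM.
    exact: (measurableT_comp mw measurable_fst).
  exact: (measurableT_comp mv measurable_snd).
apply/integrableP; split => //.
under eq_integral do rewrite /= ger0_norm ?mulr_ge0//.
rewrite (fubini_tonelli1 (EFin \o (fun p : T1 * T2 => w p.1 * v p.2)))//; last first.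
  by move=> p; rewrite lee_fin mulr_ge0.
rewrite /fubini_F /=.
under eq_integral => x _.
  under eq_integral do rewrite EFinM.
  rewrite ge0_integralZl_EFin//; last 2 first.
    by move=> y _; rewrite lee_fin.
    exact/measurable_EFinP.
  rewrite -(fineK (integrable_fin_num measurableT iv)) muleC; over.
rewrite ge0_integralZl_EFin//.
- rewrite -(fineK (integrable_fin_num measurableT iw)) -EFinM; exact: ltry.
- by move=> x _; rewrite lee_fin.
- exact/measurable_EFinP.
- by apply: fine_ge0; apply: integral_ge0 => y _; rewrite lee_fin.
Qed.

End fubini_complex.

Section cintegral_bound.
Context d (T : measurableType d) (R : realType).
Variable mu : {measure set T -> \bar R}.
Variables (Omega : set T) (mO : measurable Omega) (fO : (mu Omega < +oo)%E).
Local Notation chi := (\1_Omega : T -> R).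

Lemma Rintegral_indicM_sq_le (u : T -> R) (c : R) : measurable_fun setT u ->
  (forall x, Omega x -> u x ^+ 2 <= c) -> 0 <= c ->
  (\int[mu]_x (chi x * u x)) ^+ 2 <= fine (mu Omega) ^+ 2 * c.
Proof.
move=> mu' uc c0.
have us x : Omega x -> `|u x| <= Num.sqrt c.
  by move=> Ox; rewrite -sqrtr_sqr ler_wsqrtr// uc.
have ichi := integrable_indic_fin mO fO.
have iu := integrable_indicM mO fO mu' us.
have h : `|\int[mu]_x (chi x * u x)| <= Num.sqrt c * fine (mu Omega).
  apply: (le_trans (le_normr_Rintegral _ iu)) => //.
  rewrite -Rintegral_indic// -RintegralZl//; apply: le_Rintegral => //.
  - exact: (integrable_norm iu).
  - exact: integrable_scale.
  move=> x _; rewrite normrM indicE; have [xO|xO] := boolP (x \in Omega).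
    by rewrite normr1 mul1r mulr1 us//; exact: set_mem.
  by rewrite normr0 mul0r mulr0.
rewrite -real_normK ?num_real// -[X in _ <= _ * X](sqr_sqrtr c0) -exprMn mulrC.
by rewrite lerXn2r ?nnegrE// mulr_ge0// fine_ge0.
Qed.

Lemma sqmod_Cintegral_indicM_le (f : T -> R[i]) (c : R) : cmeasurable f ->
  (forall x, Omega x -> sqmod (f x) <= c) -> 0 <= c ->
  sqmod (Cintegral mu setT (fun x => (chi x)%:C * f x)) <=
  2 * fine (mu Omega) ^+ 2 * c.
Proof.
move=> [f1 f2] fc c0; rewrite /sqmod /= -mulrA mulr_natl mulr2n lerD//.
- under eq_Rintegral do rewrite Re_realM.
  apply: Rintegral_indicM_sq_le => // x Ox; apply: le_trans (fc _ Ox).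
  by rewrite /sqmod lerDl sqr_ge0.
- under eq_Rintegral do rewrite Im_realM.
  apply: Rintegral_indicM_sq_le => // x Ox; apply: le_trans (fc _ Ox).
  by rewrite /sqmod lerDr sqr_ge0.
Qed.

End cintegral_bound.

(** * The localization operator at a given vector *)

Section euclidean.
Context {R : realType} {n : nat}.
Implicit Types x y : Rn R n.

Lemma dot_ge0 x : 0 <= dot x x.
Proof. by apply: sumr_ge0 => i _; rewrite -expr2 sqr_ge0. Qed.

Lemma tnth_tsub x y i : tnth (tsub x y) i = tnth x i - tnth y i.
Proof. by rewrite tnth_mktuple. Qed.

Lemma dot_le_tsub x y : dot y y <= 2 * dot (tsub y x) (tsub y x) + 2 * dot x x.
Proof.
rewrite /dot !mulr_sumr -big_split; apply: ler_sum => i _ /=.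
rewrite !tnth_tsub; have := sqr_ge0 (tnth y i - 2 * tnth x i).
by rewrite expr2; lra.
Qed.

(** The parallelogram law for y and y - x, which completes the square in the
    product of two shifted Gaussians. *)
Lemma dot_midpoint x y : dot y y + dot (tsub y x) (tsub y x) =
  2 * dot (tsub y (tscale 2^-1 x)) (tsub y (tscale 2^-1 x)) + dot x x / 2.
Proof.
rewrite /dot mulr_suml mulr_sumr -!big_split; apply: eq_bigr => i _ /=.
by rewrite !tnth_tsub tnth_mktuple; field.
Qed.

Lemma dot_cauchy_schwarz x y : dot x y ^+ 2 <= dot x x * dot y y.
Proof.
have [y0|y0] := eqVneq (dot y y) 0.
  rewrite y0 mulr0 (_ : dot x y = 0) ?expr0n//.
  rewrite /dot big1// => i _.
  have /eqP : dot y y = 0 by [].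
  rewrite psumr_eq0 => [/allP/(_ i)|j _]; last by rewrite -expr2 sqr_ge0.
  by rewrite mem_index_enum => /(_ isT); rewrite mulf_eq0 orbb => /eqP ->; rewrite mulr0.
have py : 0 < dot y y by rewrite lt0r y0 dot_ge0.
have : 0 <= \sum_(i < n) (dot y y * tnth x i - dot x y * tnth y i) ^+ 2.
  by apply: sumr_ge0 => i _; exact: sqr_ge0.
have -> : \sum_(i < n) (dot y y * tnth x i - dot x y * tnth y i) ^+ 2 =
    dot y y * (dot x x * dot y y - dot x y ^+ 2).
  under eq_bigr => i _.
    rewrite (_ : _ ^+ 2 = dot y y ^+ 2 * (tnth x i * tnth x i) +
      - (2 * dot y y * dot x y) * (tnth x i * tnth y i) +
      dot x y ^+ 2 * (tnth y i * tnth y i)); last by ring.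
    over.
  rewrite !big_split -!mulr_sumr -/(dot x x) -/(dot x y) -/(dot y y).
  by rewrite /=; ring.
by rewrite pmulr_rge0// subr_ge0.
Qed.

End euclidean.

Section hs_lower_bound.
Context {R : realType} {d : nat}.
Local Notation X := (Rn R d).
Local Notation Z := (Rn R d * Rn R d)%type.
Local Notation mu := (lebesgue R d).
Local Notation mu2 := (lebesgue2 R d).
Implicit Types (x y : X) (z : Z) (f g : X -> R[i]).
Variables (Omega : set Z) (mO : measurable Omega) (fO : (mu2 Omega < +oo)%E).
Local Notation chi := (\1_Omega : Z -> R).

(** One term of the sum over an orthonormal basis that contains f. *)
Lemma hsnormsq_locop_ge f : L2fun mu f -> inner mu f f = 1 ->
  (normsq mu (locop Omega f) <= hsnormsq mu (locop Omega))%E.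
Proof.
move=> lf f1; have [E oE Ef] := exists_onb_mem lf f1.
apply: (@le_trans _ _ (\esum_(e in E) normsq mu (locop Omega e))%E); last first.
  by apply: ereal_sup_ubound; exists E.
apply: esum_ge; exists [set f].
  by split; [exact: finite_set1|move=> _ ->].
by rewrite fsbig_set1.
Qed.

Let sg2 : {sigma_finite_measure set Z -> \bar R} :=
  product_sigma_finite_measure mu mu.

Variables (r : R) (Or : forall z, Omega z -> dot z.1 z.1 <= r).
Variables (f : X -> R[i]) (lf : L2fun mu f).

Let N := fine (normsq mu f).
Let N0 : 0 <= N. Proof. by rewrite fine_ge0 ?normsq_ge0. Qed.
Let m := fine (mu2 Omega).
Let m0 : 0 <= m. Proof. by rewrite fine_ge0. Qed.

(* Dominates |V f z phi_z y|^2 for z in Omega, because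
   |y|^2 <= 2 |y - x|^2 + 2 |x|^2. *)
Let H y : R := N * (gauss_cst (R:=R) (d:=d) ^+ 2 * expR (2 * pi * r)) *
  expR (- (pi * dot (tsub y origin) (tsub y origin))).

Let H0 y : 0 <= H y.
Proof. by rewrite !mulr_ge0// ?expR_ge0// ltW// gauss_cst_gt0. Qed.

Let tsub0 y : tsub y origin = y.
Proof. by apply: eq_from_tnth => i; rewrite tnth_tsub tnth_mktuple subr0. Qed.

Let iH : mu.-integrable setT (EFin \o H).
Proof.
apply: integrable_scale; apply/integrableP; split.
  exact: measurable_gaussn.
under eq_integral do rewrite /= ger0_norm ?expR_ge0//.
by rewrite integral_gaussn ?pi_gt0// ltry.
Qed.

Let leH z y : Omega z -> sqmod (stft f z * atom z y) <= H y.
Proof.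
move=> Oz; rewrite sqmodM /H -mulrA ler_pM ?sqmod_ge0 ?sqmod_stft_le//.
rewrite sqmod_atom -[leRHS]mulrA ler_wpM2l ?sqr_ge0// -expRD ler_expR tsub0.
have := dot_le_tsub z.1 y; have := Or Oz; have := pi_gt0 R.
move: (dot y y) (dot z.1 z.1) (dot (tsub y z.1) (tsub y z.1)) => a b c p0 br ac.
have : 0 <= pi * (2 * c + 2 * r - a) by apply: mulr_ge0; [exact: ltW|lra].
by lra.
Qed.

(* The value of the adjoint, written as a superposition of atoms. *)
Let h y : R[i] := Cintegral mu2 setT
  (fun z => (chi z)%:C * (stft f z * atom z y)).

Let mVa d' (T : measurableType d') (u : T -> Z) (v : T -> X) :
  measurable_fun setT u -> measurable_fun setT v ->
  cmeasurable (fun t => stft f (u t) * atom (u t) (v t)).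
Proof.
move=> mu' mv; apply: cmeasurableM; last exact: cmeasurable_atom.
have [s1 s2] := cmeasurable_stft lf.
by split; [exact: (measurableT_comp s1 mu')|exact: (measurableT_comp s2 mu')].
Qed.

Let mchi d' (T : measurableType d') (u : T -> Z) : measurable_fun setT u ->
  cmeasurable (fun t => (chi (u t))%:C).
Proof.
move=> mu'; apply: cmeasurable_real.
by apply: (@measurableT_comp _ _ _ _ _ _ chi) => //; exact: measurable_indic.
Qed.

Let lh : L2fun mu h.
Proof.
have mK : cmeasurable (fun p : X * Z =>
    (chi p.2)%:C * (stft f p.2 * atom p.2 p.1)).
  by apply: cmeasurableM; [exact: mchi|exact: mVa].
have mh : cmeasurable h.
  by split; [exact: (measurable_Rintegral_param sg2 mK.1)|
             exact: (measurable_Rintegral_param sg2 mK.2)].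
apply: L2funP => //.
apply: le_integrable (integrable_scale (2 * m ^+ 2) iH) => //.
  by apply/measurable_EFinP; exact: measurable_sqmod.
move=> y _ /=; rewrite lee_fin ger0_norm ?sqmod_ge0// ger0_norm; last first.
  by rewrite mulr_ge0// mulr_ge0// sqr_ge0.
apply: sqmod_Cintegral_indicM_le => //; last by move=> z; exact: leH.
exact: mVa.
Qed.

(* Both sides are iterated integrals of the same function K on X * Z. *)
Let hadj g : L2fun mu g ->
  inner mu h g = inner mu2 (fun z => (chi z)%:C * stft f z) (stft g).
Proof.
move=> lg.
pose K (p : X * Z) :=
  ((chi p.2)%:C * (stft f p.2 * atom p.2 p.1)) * conjc (g p.1).
have mK : cmeasurable K.
  apply: cmeasurableM; first by apply: cmeasurableM; [exact: mchi|exact: mVa].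
  apply: cmeasurable_conj; have [g1 g2] := L2fun_cmeasurable lg.
  by split; [exact: (measurableT_comp g1 measurable_fst)|
             exact: (measurableT_comp g2 measurable_fst)].
have iW : mu.-integrable setT (EFin \o (fun y => H y + sqmod (g y))).
  by apply: integrable_add => //; exact: L2fun_integrable.
have iK : cintegrable (mu \x sg2)%E K.
  have ib : (mu \x sg2)%E.-integrable setT
      (EFin \o (fun p : X * Z => (H p.1 + sqmod (g p.1)) * chi p.2)).
    apply: (@integrable_tensor _ _ _ _ _ mu sg2 (fun y => H y + sqmod (g y)) chi)
      => //; first exact: integrable_indic_fin.
    by move=> y; rewrite addr_ge0// sqmod_ge0.
  have KE p : K p = (chi p.2)%:C * ((stft f p.2 * atom p.2 p.1) * conjc (g p.1)).
    by rewrite /K; apply/esym/mulrA.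
  apply: (cintegrable_le mK ib) => -[y z]; rewrite KE ?Re_realM ?Im_realM;
    rewrite normrM mulrC indicE;
    have [zO|_] := boolP (z \in Omega); rewrite ?normr0 ?mulr0// normr1 !mulr1.
  + rewrite (le_trans (ReM_conj_le _ _))// lerD2r.
    exact/leH/set_mem.
  + rewrite (le_trans (ImM_conj_le _ _))// lerD2r.
    exact/leH/set_mem.
have iy y : cintegrable sg2 (fun z => (chi z)%:C * (stft f z * atom z y)).
  apply: (cintegrable_indicM mO fO (c := H y)); first exact: mVa.
  by move=> z; exact: leH.
have Kx y : cintegrable sg2 (fun z => K (y, z)).
  rewrite (_ : (fun z => _) = (fun z => conjc (g y) *
      ((chi z)%:C * (stft f z * atom z y)))); first exact: cintegrableZ.
  by apply/funext => z; rewrite /K mulrC.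
have Ky z : cintegrable mu (fun y => K (y, z)).
  rewrite (_ : (fun y => _) = (fun y => ((chi z)%:C * stft f z) *
      (atom z y * conjc (g y)))).
    by apply: cintegrableZ; apply: cintegrable_inner => //; exact: L2fun_atom.
  by apply/funext => y; rewrite /K /= !mulrA.
transitivity (Cintegral mu setT (fun y => Cintegral sg2 setT (fun z => K (y, z)))).
  congr Cintegral; apply/funext => y; rewrite mulrC -CintegralZl//.
  by congr Cintegral; apply/funext => z; rewrite /K mulrC.
rewrite (Cintegral_fubini iK Kx Ky); congr Cintegral; apply/funext => z.
rewrite (stftE g) (inner_conj (L2fun_atom z) lg) conjcK -CintegralZl.
  by congr Cintegral; apply/funext => y; rewrite /K /= !mulrA.
by apply: cintegrable_inner => //; exact: L2fun_atom.
Qed.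

(** When the first components of the points of Omega are bounded, the Hilbert
    adjoint defining [locop] exists: it is the superposition of the atoms phi_z,
    z in Omega, with weights V f z. *)
Lemma locopP : L2fun mu (locop Omega f) /\ forall g, L2fun mu g ->
  inner mu (locop Omega f) g =
  inner mu2 (fun z => (chi z)%:C * stft f z) (stft g).
Proof.
exact: (@xgetPex _ (fun=> 0) [set k | L2fun mu k /\ forall g, L2fun mu g ->
  inner mu k g = inner mu2 (fun z => (chi z)%:C * stft f z) (stft g)]
  (ex_intro _ h (conj lh hadj))).
Qed.

End hs_lower_bound.

(** * The lower bound for the Hilbert-Schmidt norm *)

Section trigonometric_bounds.
Context {R : realType}.

Lemma sin_le_self (u : R) : 0 <= u -> sin u <= u.
Proof.
move=> u0.
have [|c _] := @MVT_segment R sin cos 0 u u0 (fun x _ => is_derive_sin x).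
  exact/continuous_subspaceT/continuous_sin.
by rewrite sin0 !subr0 => ->; rewrite ler_piMl// cos_le1.
Qed.

Lemma sqr_sin_le (u : R) : sin u ^+ 2 <= u ^+ 2.
Proof.
wlog u0 : u / 0 <= u => [h|].
  have [/h//|u0] := lerP 0 u.
  by rewrite -[u in leLHS]opprK sinN sqrrN -[leRHS]sqrrN h// oppr_ge0 ltW.
have su := sin_le_self u0; have [s0|s0] := lerP 0 (sin u).
  by rewrite lerXn2r ?nnegrE.
have [u1|u1] := lerP 1 u.
  have := sin2cos2 u; have := sqr_ge0 (cos u).
  have : 1 <= u ^+ 2 by rewrite -(expr1n _ 2) lerXn2r ?nnegrE.
  by rewrite sin2cos2; lra.
have : 0 <= sin u.
  apply: sin_ge0_pi; rewrite u0/= (le_trans (ltW u1))//.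
  by rewrite (le_trans _ (pi_ge2 R))// ler1n.
by rewrite leNgt s0.
Qed.

(** From cos u = 1 - 2 sin (u / 2) ^ 2. *)
Lemma cos_ge (u : R) : 1 - u ^+ 2 / 2 <= cos u.
Proof.
have -> : cos u = cos (u / 2) ^+ 2 *+ 2 - 1.
  by rewrite -cos_mulr2n -(mulr_natr (u / 2)) divfK.
have := sqr_sin_le (u / 2); rewrite expr_div_n cos2sin2 -mulr_natr => h.
by lra.
Qed.

End trigonometric_bounds.

Section gaussian_stft.
Context {R : realType} {d : nat}.
Local Notation X := (Rn R d).
Local Notation Z := (Rn R d * Rn R d)%type.
Local Notation mu := (lebesgue R d).
Local Notation mu2 := (lebesgue2 R d).
Implicit Types (x y : X) (z : Z).

Local Notation phi := (atom ((origin, origin) : Z)).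
Local Notation c2 := (gauss_cst (R:=R) (d:=d) ^+ 2).

Definition gauss a (m : X) y : R := expR (- (a * dot (tsub y m) (tsub y m))).

Lemma integrable_gauss a m : 0 < a -> mu.-integrable setT (EFin \o gauss a m).
Proof.
move=> a0; apply/integrableP; split; first exact: measurable_gaussn.
under eq_integral do rewrite /= ger0_norm ?expR_ge0//.
by rewrite integral_gaussn// ltry.
Qed.

Lemma Rintegral_gauss a m : 0 < a ->
  \int[mu]_y gauss a m y = Num.sqrt (pi / a) ^+ d.
Proof. by move=> a0; rewrite /Rintegral integral_gaussn. Qed.

Lemma tsub_origin y : tsub y origin = y.
Proof. by apply: eq_from_tnth => i; rewrite tnth_tsub tnth_mktuple subr0. Qed.

Lemma Re_gaussian_atom z y : Re (phi y * conjc (atom z y)) =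
  gaussian y * gaussian (tsub y z.1) * cos (2 * pi * dot z.2 y).
Proof.
rewrite /atom tsub_origin (_ : dot origin y = 0); last first.
  by rewrite /dot big1// => i _; rewrite tnth_mktuple mul0r.
rewrite mulr0 Re_mul Re_conjc Im_conjc !Re_realM !Im_realM /= cos0 sin0.
by rewrite mulr1 mulr0 mul0r subr0 mulrA.
Qed.

(** The product of two Gaussians is a Gaussian centred at the midpoint of their
    centres. *)
Lemma gaussian_shift_product x y :
  gaussian y * gaussian (tsub y x) =
  c2 * expR (- (pi / 2 * dot x x)) * gauss (2 * pi) (tscale 2^-1 x) y.
Proof.
rewrite /gaussian /gauss mulrACA -expr2 -mulrA -!expRD; congr (_ * expR _).
have := dot_midpoint x y; set a := dot y y; set b := dot (tsub y x) _.
set c := dot (tsub y (tscale _ _)) _ => abc.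
by have -> : - pi * a + - pi * b = - pi * (a + b) by [rewrite mulrDr|];
  rewrite abc; field.
Qed.

(** Bounding the cosine below by its quadratic Taylor polynomial costs a factor
    |omega|^2 |y|^2; the weight |y|^2 is absorbed by one of the two Gaussians, as
    u exp (- u) <= 1, and the other one remains. *)
Lemma Re_gaussian_atom_ge z y :
  expR (- (pi / 2 * dot z.1 z.1)) * c2 * gauss (2 * pi) (tscale 2^-1 z.1) y -
  2 * pi * dot z.2 z.2 * c2 * gauss pi z.1 y <=
  Re (phi y * conjc (atom z y)).
Proof.
have p0 := pi_gt0 R.
rewrite Re_gaussian_atom.
set G := gaussian y * gaussian (tsub y z.1).
have G0 : 0 <= G by rewrite mulr_ge0// gaussian_ge0.
have -> : expR (- (pi / 2 * dot z.1 z.1)) * c2 *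
    gauss (2 * pi) (tscale 2^-1 z.1) y = G.
  by rewrite /G gaussian_shift_product; ring.
have : G * (1 - (2 * pi * dot z.2 y) ^+ 2 / 2) <=
    G * cos (2 * pi * dot z.2 y) by rewrite ler_wpM2l// cos_ge.
apply: le_trans; rewrite mulrBr mulr1 lerD2l lerN2.
have -> : G = c2 * (expR (- (pi * dot y y)) * gauss pi z.1 y).
  by rewrite /G /gaussian /gauss mulrACA !mulNr -expr2.
have g0 : 0 <= gauss pi z.1 y by exact: expR_ge0.
apply: (@le_trans _ _ (c2 * (expR (- (pi * dot y y)) * gauss pi z.1 y) *
    (2 * pi * dot z.2 z.2 * (pi * dot y y)))).
  apply: ler_wpM2l; first by rewrite mulr_ge0 ?sqr_ge0// mulr_ge0 ?expR_ge0.
  have h : 2 * pi ^+ 2 * dot z.2 y ^+ 2 <=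
           2 * pi ^+ 2 * (dot z.2 z.2 * dot y y).
    by apply: ler_wpM2l; [exact/mulr_ge0/sqr_ge0|exact: dot_cauchy_schwarz].
  have -> : (2 * pi * dot z.2 y) ^+ 2 / 2 = 2 * pi ^+ 2 * dot z.2 y ^+ 2.
    by field.
  by rewrite [leRHS](_ : _ = 2 * pi ^+ 2 * (dot z.2 z.2 * dot y y))//; ring.
have e1 : expR (- (pi * dot y y)) * (pi * dot y y) <= 1.
  rewrite expRN mulrC ler_pdivrMr ?expR_gt0// mul1r.
  by apply: le_trans (expR_ge1Dx _); rewrite lerDr.
rewrite [leLHS](_ : _ = c2 * gauss pi z.1 y * (2 * pi * dot z.2 z.2) *
  (expR (- (pi * dot y y)) * (pi * dot y y))); last by ring.
rewrite [leRHS](_ : _ = c2 * gauss pi z.1 y * (2 * pi * dot z.2 z.2) * 1);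
  last by ring.
apply: ler_wpM2l => //; apply: mulr_ge0; first by rewrite mulr_ge0 ?sqr_ge0.
by rewrite mulr_ge0 ?dot_ge0// mulr_ge0// ltW.
Qed.

Lemma gauss_cst_ge1 : 1 <= c2.
Proof.
by apply: exprn_ege1; rewrite /gauss_cst -[leLHS](powRr0 2) ler_powR ?ler1n// divr_ge0.
Qed.

(** Integrating the preceding bound: V phi z is close to its value 1 at z = 0,
    with a quadratic error. *)
Lemma Re_stft_gaussian_ge z :
  1 - 2 * pi * c2 * (dot z.1 z.1 + dot z.2 z.2) <= Re (stft phi z).
Proof.
have p0 := pi_gt0 R.
have p2 : 0 < 2 * pi :> R by rewrite mulr_gt0.
pose A := expR (- (pi / 2 * dot z.1 z.1)).
pose B := 2 * pi * dot z.2 z.2 * c2.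
apply: (@le_trans _ _ (A - B)).
  have := expR_ge1Dx (- (pi / 2 * dot z.1 z.1)); rewrite -/A.
  have : 0 <= pi * dot z.1 z.1 * (c2 - 1).
    by rewrite !mulr_ge0 ?dot_ge0 ?subr_ge0 ?gauss_cst_ge1// ltW.
  have : 0 <= pi * dot z.1 z.1 * c2.
    by rewrite !mulr_ge0 ?dot_ge0// ltW// gauss_cst_gt0.
  have : 0 <= pi * dot z.1 z.1 by rewrite mulr_ge0 ?dot_ge0// ltW.
  by rewrite /B; lra.
have i1 := integrable_scale (A * c2) (integrable_gauss (tscale 2^-1 z.1) p2).
have i2 := integrable_scale B (integrable_gauss z.1 p0).
rewrite stftE.
apply: (@le_trans _ _ (\int[mu]_y (A * c2 * gauss (2 * pi) (tscale 2^-1 z.1) y -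
    B * gauss pi z.1 y))).
  rewrite RintegralB// !RintegralZl//; [|exact: integrable_gauss..].
  rewrite !Rintegral_gauss// divff ?gt_eqF// sqrtr1 expr1n mulr1.
  by rewrite -mulrA gauss_cst_norm mulr1.
apply: le_Rintegral => //.
- exact: (@integrableB _ _ _ mu _ measurableT _ _ i1 i2).
- exact: (cintegrable_inner (L2fun_atom _) (L2fun_atom _)).1.
- by move=> y _; exact: Re_gaussian_atom_ge.
Qed.

(** Bessel's inequality along phi gives |L phi|^2 >= <L phi, phi>^2, which is at
    least (|Omega| (1 - C r)^2)^2 with C = 2 pi c2; then
    (1 - C r)^4 >= 1 - 4 C r. *)
Lemma hsnormsq_locop_gaussian_ge (Omega : set Z) (r : R) :
  measurable Omega -> (mu2 Omega < +oo)%E ->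
  (forall z, Omega z -> dot z.1 z.1 + dot z.2 z.2 <= r) ->
  ((fine (mu2 Omega) ^+ 2 * (1 - 8 * pi * c2 * r))%:E <=
   hsnormsq mu (locop Omega))%E.
Proof.
move=> mO fO Or; set C := 2 * pi * c2; set m := fine _.
have p0 := pi_gt0 R.
have m0 : 0 <= m by rewrite fine_ge0.
have C0 : 0 < C by rewrite !mulr_gt0// gauss_cst_gt0.
have lphi : L2fun mu phi := L2fun_atom _.
have phi1 : inner mu phi phi = 1 := inner_atom _.
apply: le_trans (hsnormsq_locop_ge Omega lphi phi1).
have CE : 8 * pi * c2 * r = 4 * (C * r) by rewrite /C; ring.
(* When C r > 1 the left-hand side is nonpositive. *)
have [Cr|Cr] := lerP (C * r) 1; last first.
  apply: le_trans (normsq_ge0 _ _); rewrite lee_fin CE.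
  by rewrite mulr_ge0_le0 ?sqr_ge0//; lra.
have Or1 z : Omega z -> dot z.1 z.1 <= r.
  by move=> Oz; rewrite (le_trans _ (Or _ Oz))// lerDl dot_ge0.
have [lh hadj] := locopP mO fO Or1 lphi.
rewrite -(fineK (normsq_fin_num lh)) lee_fin.
apply: le_trans (bessel1 lphi lh phi1).
have le1 : m * (1 - C * r) ^+ 2 <= Re (inner mu (locop Omega phi) phi).
  rewrite hadj//.
  have ichi := integrable_indic_fin mO fO.
  rewrite mulrC /m -Rintegral_indic// -RintegralZl//.
  apply: le_Rintegral => //; first exact: integrable_scale.
    under [X in EFin \o X]eq_fun do rewrite -mulrA mul_conjc Re_realM.
    apply: (@integrable_indicM _ _ _ mu2 _ mO fO _ 1).
      exact/measurable_sqmod/cmeasurable_stft.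
    move=> z _; rewrite ger0_norm ?sqmod_ge0//.
    by rewrite (le_trans (sqmod_stft_le _ lphi))// normsq_atom.
  move=> z _; rewrite -mulrA mul_conjc Re_realM /= mulrC indicE.
  have [/set_mem zO|_] := boolP (z \in Omega); last by rewrite !mul0r.
  rewrite !mul1r (@le_trans _ _ (Re (stft phi z) ^+ 2))//.
    rewrite lerXn2r ?nnegrE ?subr_ge0//.
      apply: le_trans (Re_stft_gaussian_ge z).
      by rewrite subr_ge0 -/C (le_trans _ Cr)// ler_pM2l// Or.
    apply: le_trans (Re_stft_gaussian_ge z).
    by rewrite lerD2l lerN2 -/C ler_pM2l// Or.
  by rewrite /sqmod lerDl sqr_ge0.
apply: (@le_trans _ _ ((m * (1 - C * r) ^+ 2) ^+ 2)).
  rewrite exprMn ler_wpM2l ?sqr_ge0//.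
  rewrite CE; move: Cr; move: (C * r) => q q1.
  have -> : ((1 - q) ^+ 2) ^+ 2 = 1 - 4 * q + q ^+ 2 * (2 + (2 - q) ^+ 2) by ring.
  by rewrite lerDl mulr_ge0 ?sqr_ge0// addr_ge0 ?sqr_ge0.
rewrite (@le_trans _ _ (Re (inner mu (locop Omega phi) phi) ^+ 2))//.
  have h0 : 0 <= m * (1 - C * r) ^+ 2 by rewrite mulr_ge0 ?sqr_ge0.
  by rewrite lerXn2r ?nnegrE// (le_trans h0).
by rewrite /sqmod lerDl sqr_ge0.
Qed.

End gaussian_stft.

(** * Balls and cubes in phase space *)

Section balls.
Context {R : realType} {d : nat}.
Local Notation X := (Rn R d).
Local Notation Z := (Rn R d * Rn R d)%type.
Local Notation mu := (lebesgue R d).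
Local Notation mu2 := (lebesgue2 R d).
Implicit Types (x y : X) (z c : Z) (r : R).

Definition tcst (a : R) : X := [tuple a | i < d].

Lemma tnth_tcst a i : tnth (tcst a) i = a.
Proof. exact: tnth_mktuple. Qed.

Definition sqdist z c : R :=
  dot (tsub z.1 c.1) (tsub z.1 c.1) + dot (tsub z.2 c.2) (tsub z.2 c.2).

Lemma sqdist_ge0 z c : 0 <= sqdist z c.
Proof. by rewrite addr_ge0 ?dot_ge0. Qed.

Lemma ball2E c r : ball2 c r = [set z | 0 < r /\ sqdist z c < r ^+ 2].
Proof.
apply/seteqP; split=> z /=; rewrite -/(sqdist z c);
  [move=> zr|move=> [r0 zr]].
  have r0 : 0 < r by rewrite (le_lt_trans _ zr).
  by rewrite -(sqr_sqrtr (sqdist_ge0 z c)) ltrXn2r// nnegrE ltW.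
rewrite /ball2 /= -/(sqdist z c) -[X in _ < X](ger0_norm (ltW r0)).
by rewrite -sqrtr_sqr ltr_sqrt// exprn_gt0.
Qed.

Lemma measurable_ball2 c r : measurable (ball2 c r).
Proof.
rewrite ball2E; have [r0|r0] := ltP 0 r; last first.
  rewrite (_ : [set z | _] = set0); first exact: measurable0.
  by apply/seteqP; split => // z [].
have mD : measurable_fun setT (sqdist ^~ c).
  by apply: measurable_funD; apply: measurable_dot; apply: measurable_tsub.
have := mD measurableT `]-oo, (r ^+ 2)[%classic (measurable_itv _).
rewrite setTI; congr measurable.
by apply/seteqP; split => z /=; rewrite in_itv//= => -[].
Qed.

Lemma lebesgue2_box (a1 b1 a2 b2 : X) (s1 s2 : R) : 0 <= s1 -> 0 <= s2 ->
  (forall i, tnth b1 i - tnth a1 i = s1) ->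
  (forall i, tnth b2 i - tnth a2 i = s2) ->
  mu2 (tbox a1 b1 `*` tbox a2 b2) = (s1 ^+ d * s2 ^+ d)%:E.
Proof.
move=> s10 s20 h1 h2.
rewrite EFinM -(lebesgue_tbox s10 h1) -(lebesgue_tbox s20 h2).
by apply: product_measure1E; exact: measurable_tbox.
Qed.

Lemma measurable_box (a1 b1 a2 b2 : X) :
  measurable (tbox a1 b1 `*` tbox a2 b2 : set Z).
Proof. by apply: measurableX; exact: measurable_tbox. Qed.

Lemma sqr_coord_le x i : tnth x i ^+ 2 <= dot x x.
Proof.
rewrite /dot (bigD1 i)//= -expr2 lerDl.
by apply: sumr_ge0 => j _; rewrite -expr2 sqr_ge0.
Qed.

Lemma dot_le_cst x (a : R) : (forall i, tnth x i ^+ 2 <= a) ->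
  dot x x <= d%:R * a.
Proof.
move=> xa; rewrite /dot (@le_trans _ _ (\sum_(i < d) a))//.
  by apply: ler_sum => i _; rewrite -expr2.
by rewrite sumr_const card_ord mulr_natl.
Qed.

Definition tshift x (a : R) : X := [tuple tnth x i + a | i < d].

Lemma tnth_tshift x a i : tnth (tshift x a) i = tnth x i + a.
Proof. exact: tnth_mktuple. Qed.

Definition cube c (a : R) : set Z :=
  tbox (tshift c.1 (- a)) (tshift c.1 a) `*` tbox (tshift c.2 (- a)) (tshift c.2 a).

Lemma lebesgue2_cube c a : 0 <= a -> mu2 (cube c a) = ((a *+ 2) ^+ d ^+ 2)%:E.
Proof.
move=> a0; rewrite (@lebesgue2_box _ _ _ _ (a *+ 2) (a *+ 2)) ?mulrn_wge0// => i;
  by rewrite !tnth_tshift; ring.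
Qed.

Lemma cube_sub_ball2 c r : (0 < d)%N -> 0 < r ->
  cube c (r / (2 * d%:R)) `<=` ball2 c r.
Proof.
move=> d0 r0 z [/= z1 z2]; rewrite ball2E; split => //.
have dR : 1 <= d%:R :> R by rewrite ler1n.
have dR0 : 0 < d%:R :> R by rewrite (lt_le_trans _ dR).
set a := r / _ in z1 z2.
have a0 : 0 < a by rewrite divr_gt0// mulr_gt0.
have le x y : tbox (tshift y (- a)) (tshift y a) x ->
    dot (tsub x y) (tsub x y) <= d%:R * a ^+ 2.
  move=> xy; apply: dot_le_cst => i; have := xy i.
  rewrite tnth_tsub !tnth_tshift => /andP[l u].
  have : 0 <= (a - (tnth x i - tnth y i)) * (a + (tnth x i - tnth y i)).
    by apply: mulr_ge0; lra.
  by lra.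
apply: (@le_lt_trans _ _ (d%:R * a ^+ 2 + d%:R * a ^+ 2)).
  by rewrite lerD// le.
have -> : r = a * (2 * d%:R) by rewrite /a divfK// mulf_neq0// gt_eqF.
move: (d%:R) dR dR0 => D D1 D0; rewrite -subr_gt0.
rewrite (_ : _ - _ = a ^+ 2 * (D * (4 * D - 2))); last by ring.
by rewrite mulr_gt0 ?exprn_gt0// mulr_gt0//; lra.
Qed.

Lemma ball2_sub_cube c r : 0 < r -> ball2 c r `<=` cube c r.
Proof.
move=> r0 z; rewrite ball2E => -[_ zr].
have le x y : dot (tsub x y) (tsub x y) < r ^+ 2 ->
    tbox (tshift y (- r)) (tshift y r) x.
  move=> xy i; have := le_lt_trans (sqr_coord_le _ i) xy.
  rewrite tnth_tsub !tnth_tshift -ltr_sqrt ?exprn_gt0// !sqrtr_sqr.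
  rewrite [X in _ < X]gtr0_norm// ltr_norml => /andP[l u].
  by apply/andP; split; lra.
by split; apply: le; apply: le_lt_trans zr;
  rewrite /sqdist ?lerDl ?lerDr dot_ge0.
Qed.

(** A ball of radius r contains a cube of side r / d. *)
Lemma ball2_radius c r : (0 < d)%N -> 0 < r ->
  (((r / d%:R) ^+ d ^+ 2)%:E <= mu2 (ball2 c r))%E.
Proof.
move=> d0 r0.
have a0 : 0 < r / (2 * d%:R) by rewrite divr_gt0// mulr_gt0// ltr0n.
have := lebesgue2_cube c (ltW a0).
rewrite (_ : r / (2 * d%:R) *+ 2 = r / d%:R); last first.
  by rewrite -mulr_natr; field; rewrite pnatr_eq0 -lt0n.
move=> <-; apply: le_measure; rewrite ?inE.
- exact: measurable_box.
- exact: measurable_ball2.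
- exact: cube_sub_ball2.
Qed.

Lemma dot_tscale x s : dot (tscale s x) (tscale s x) = s ^+ 2 * dot x x.
Proof.
rewrite /dot mulr_sumr; apply: eq_bigr => i _.
by rewrite !tnth_mktuple; ring.
Qed.

(** Dilating both components of phase space by r. *)
Lemma lebesgue2_ball2 r : 0 < r ->
  (mu2 (ball2 (origin, origin) r) =
   (r ^+ d ^+ 2)%:E * mu2 (ball2 (origin, origin) 1))%E.
Proof.
move=> r0; set B := ball2 _; set s := r^-1.
have s0 : 0 < s by rewrite invr_gt0.
pose F (z : Z) : \bar R := (\1_(B 1) z)%:E.
have mF : measurable_fun setT F.
  by apply/measurable_EFinP; apply: measurable_indic; exact: measurable_ball2.
have F0 z : (0 <= F z)%E by rewrite lee_fin.
have ms := @measurable_tscale R d s.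
have mFx x : measurable_fun setT (fun y => F (x, y)).
  by apply: measurableT_comp => //; exact: measurable_pair1.
have mFs : measurable_fun setT (fun z : Z => F (tscale s z.1, tscale s z.2)).
  apply: measurableT_comp => //; apply: measurable_fun_pair.
    exact: (measurableT_comp ms measurable_fst).
  exact: (measurableT_comp ms measurable_snd).
have Bs : mu2 (B r) = (\int[mu2]_z F (tscale s z.1, tscale s z.2))%E.
  have -> : mu2 (B r) = (\int[mu2]_z (\1_(B r) z)%:E)%E.
    by rewrite integral_indic ?setIT//; exact: measurable_ball2.
  apply: eq_integral => z _; rewrite /F !indicE.
  suff -> : (z \in B r) = ((tscale s z.1, tscale s z.2) \in B 1) by [].
  have sr : sqdist (tscale s z.1, tscale s z.2) (origin, origin) < 1 ^+ 2 <->
            sqdist z (origin, origin) < r ^+ 2.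
    rewrite /sqdist /= !tsub_origin !dot_tscale -mulrDr /s expr1n exprVn.
    by rewrite mulrC ltr_pdivrMr ?exprn_gt0// mul1r.
  by apply/idP/idP; rewrite !inE /B !ball2E /= => -[_ /sr].
pose G x : \bar R := (\int[mu]_y F (x, y))%E.
have mG : measurable_fun setT G by exact: measurable_fun_fubini_tonelli_F.
have G0 x : (0 <= G x)%E by exact: integral_ge0.
have scale (H : X -> \bar R) : measurable_fun setT H -> (forall y, 0 <= H y)%E ->
    (\int[mu]_y H (tscale s y) = (r ^+ d)%:E * \int[mu]_y H y)%E.
  move=> mH H0; rewrite -(ge0_integral_tscale s0 mH)// muleA -EFinM -exprMn.
  by rewrite /s mulfV ?gt_eqF// expr1n mul1e.
have inner x : (\int[mu]_y F (tscale s x, tscale s y) =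
    (r ^+ d)%:E * G (tscale s x))%E.
  by apply: (scale (fun y => F (tscale s x, y))) => // y; exact: F0.
rewrite Bs lebesgue2_integral//=.
under eq_integral do rewrite inner.
rewrite ge0_integralZl_EFin//.
- rewrite (scale G)// muleA -EFinM -expr2; congr (_ * _)%E.
  rewrite /G -lebesgue2_integral// integral_indic ?setIT//.
  exact: measurable_ball2.
- exact: (measurableT_comp mG ms).
- by rewrite exprn_ge0// ltW.
Qed.

Lemma exists_ball2 (t : R) : (0 < d)%N -> 0 < t ->
  exists r, mu2 (ball2 (origin, origin) r) = t%:E.
Proof.
move=> d0 t0; set v := mu2 (ball2 (origin, origin) 1).
have v1 : (((1 / d%:R) ^+ d ^+ 2)%:E <= v)%E by exact: ball2_radius.
have v2 : (v <= ((1 *+ 2) ^+ d ^+ 2)%:E)%E.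
  rewrite -(lebesgue2_cube (origin, origin)) ?ler01//.
  apply: le_measure; rewrite ?inE.
  - exact: measurable_ball2.
  - exact: measurable_box.
  - exact: ball2_sub_cube.
have vE : v = (fine v)%:E.
  rewrite fineK// ge0_fin_numE; last exact: measure_ge0.
  by rewrite (le_lt_trans v2)// ltry.
have v0 : 0 < fine v.
  rewrite -lte_fin -vE (lt_le_trans _ v1)// lte_fin.
  by rewrite !exprn_gt0// div1r invr_gt0 ltr0n.
pose r := (t / fine v) `^ ((d * 2)%:R^-1).
have rE : r ^+ d ^+ 2 = t / fine v.
  rewrite -exprM -powR_mulrn ?powR_ge0// -powRrM mulVf ?powRr1//.
    by rewrite divr_ge0// ltW.
  by rewrite pnatr_eq0 muln_eq0 negb_or -lt0n d0.
exists r; rewrite lebesgue2_ball2; last by rewrite powR_gt0// divr_gt0.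
by rewrite -/v vE rE -EFinM divfK// gt_eqF.
Qed.

End balls.

(** * The asymmetry of two distant cubes *)

Section two_cubes.
Context {R : realType} {d : nat} (d0 : (0 < d)%N).
Local Notation X := (Rn R d).
Local Notation Z := (Rn R d * Rn R d)%type.
Local Notation mu := (lebesgue R d).
Local Notation mu2 := (lebesgue2 R d).
Implicit Types (z c : Z) (r s : R).

(** The cubes have side s, so in the first coordinate they are 4 d s apart; by
    [ball2_radius] no ball of measure 2 s^(2d) has a larger diameter. *)
Definition gap s : R := (4 * d%:R + 1) * s.

Definition near_cube s : set Z :=
  tbox (tcst 0) (tcst s) `*` tbox (tcst 0) (tcst s).

Definition far_cube s : set Z :=
  tbox (tcst (gap s)) (tcst (gap s + s)) `*` tbox (tcst 0) (tcst s).

Definition two_cubes s : set Z := near_cube s `|` far_cube s.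

Lemma measurable_two_cubes s : measurable (two_cubes s).
Proof. by apply: measurableU; exact: measurable_box. Qed.

Lemma lebesgue2_near_cube s : 0 <= s -> mu2 (near_cube s) = (s ^+ d ^+ 2)%:E.
Proof.
move=> s0; rewrite (lebesgue2_box (s1 := s) (s2 := s))// => i;
  by rewrite !tnth_tcst subr0.
Qed.

Lemma lebesgue2_far_cube s : 0 <= s -> mu2 (far_cube s) = (s ^+ d ^+ 2)%:E.
Proof.
move=> s0; rewrite (lebesgue2_box (s1 := s) (s2 := s))// => i;
  by rewrite !tnth_tcst ?subr0// addrC addKr.
Qed.

Let i0 : 'I_d := Ordinal d0.

Let dR : 1 <= d%:R :> R. Proof. by rewrite ler1n. Qed.

Lemma near_far_gap s z1 z2 : near_cube s z1 -> far_cube s z2 ->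
  4 * d%:R * s <= tnth z2.1 i0 - tnth z1.1 i0.
Proof.
move=> [/(_ i0) + _] [/(_ i0) + _]; rewrite !tnth_tcst /gap.
by move=> /andP[_ h1] /andP[h2 _]; lra.
Qed.

Lemma lebesgue2_two_cubes s : 0 < s ->
  mu2 (two_cubes s) = (s ^+ d ^+ 2 *+ 2)%:E.
Proof.
move=> s0; rewrite /two_cubes measureU; last 3 first.
- exact: measurable_box.
- exact: measurable_box.
- apply/seteqP; split => // z [z1 z2]; have := near_far_gap z1 z2.
  rewrite subrr => h; have : 0 < 4 * d%:R * s.
    by rewrite mulr_gt0// mulr_gt0// (lt_le_trans _ dR).
  by rewrite ltNge h.
transitivity (mu2 (near_cube s) + mu2 (far_cube s))%E; first by [].
by rewrite lebesgue2_near_cube ?ltW// lebesgue2_far_cube ?ltW.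
Qed.

Lemma two_cubes_bounded s z : 0 < s -> two_cubes s z ->
  dot z.1 z.1 + dot z.2 z.2 <= 2 * d%:R * (4 * d%:R + 2) ^+ 2 * s ^+ 2.
Proof.
move=> s0 Oz; have M0 : 0 <= gap s + s.
  by rewrite /gap addr_ge0 ?ltW// mulr_gt0// ltr_wpDl// mulr_ge0// ler0n.
have sM : s <= gap s + s.
  by rewrite lerDr /gap mulr_ge0 ?ltW// ltr_wpDl// mulr_ge0// ler0n.
have sq (a : R) : 0 <= a <= gap s + s -> a ^+ 2 <= (gap s + s) ^+ 2.
  by move=> /andP[a0 aM]; rewrite lerXn2r ?nnegrE.
have bnd : (forall i, 0 <= tnth z.1 i <= gap s + s) /\
           (forall i, 0 <= tnth z.2 i <= gap s + s).
  have g0 : 0 <= gap s.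
    by rewrite /gap mulr_ge0 ?ltW// ltr_wpDl// mulr_ge0// ler0n.
  case: Oz => -[h1 h2]; split=> i; move: (h1 i) (h2 i);
    by rewrite !tnth_tcst => /andP[a b] /andP[e f]; apply/andP; split; lra.
apply: (@le_trans _ _ (d%:R * (gap s + s) ^+ 2 + d%:R * (gap s + s) ^+ 2)).
  by apply: lerD; apply: dot_le_cst => i; apply: sq; case: bnd.
rewrite [leRHS](_ : _ = d%:R * (gap s + s) ^+ 2 + d%:R * (gap s + s) ^+ 2)//.
by rewrite /gap; ring.
Qed.

Lemma ball2_miss_cube s c r : r <= 2 * d%:R * s ->
  near_cube s `<=` ~` ball2 c r \/ far_cube s `<=` ~` ball2 c r.
Proof.
move=> rs; apply: contrapT => /not_orP[/existsNP[z1 /not_implyP[z1Q /contrapT]]].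
move=> + /existsNP[z2 /not_implyP[z2Q /contrapT]].
rewrite !ball2E => -[r0 z1r] [_ z2r].
have coord z : sqdist z c < r ^+ 2 -> `|tnth z.1 i0 - tnth c.1 i0| < r.
  move=> zr; rewrite -[X in _ < X]gtr0_norm// -!sqrtr_sqr ltr_sqrt ?exprn_gt0//.
  rewrite -tnth_tsub (le_lt_trans (sqr_coord_le _ _))// (le_lt_trans _ zr)//.
  by rewrite /sqdist lerDl dot_ge0.
have := near_far_gap z1Q z2Q; move: (coord _ z1r) (coord _ z2r).
by rewrite !ltr_norml => /andP[a b] /andP[e f]; lra.
Qed.

(** A ball of the same measure misses one of the cubes, which carries half of the
    measure. *)
Lemma fraenkel_two_cubes_ge s : 0 < s -> 2^-1 <= fraenkel (two_cubes s).
Proof.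
move=> s0; have P0 : 0 < s ^+ d ^+ 2 by rewrite !exprn_gt0.
have OE := lebesgue2_two_cubes s0.
have mO := measurable_two_cubes s.
apply: lb_le_inf.
  have t0 : 0 < s ^+ d ^+ 2 *+ 2 by rewrite mulrn_wgt0.
  have [r Br] := exists_ball2 d0 t0.
  exists (fine (mu2 (two_cubes s `+` ball2 (origin, origin) r)) /
      fine (mu2 (two_cubes s))).
  exists (ball2 (origin, origin) r) => //; split; first by exists (origin, origin), r.
  by rewrite OE Br.
move=> _ [B [[c [r ->]] BO] <-].
have mB := measurable_ball2 c r.
rewrite OE /= ler_pdivlMr ?mulrn_wgt0// -(mulr_natl (_ ^+ 2)) mulKf//.
have rs : r <= 2 * d%:R * s.
  have dR0 : 0 < d%:R :> R by rewrite (lt_le_trans _ dR).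
  have [r0|r0] := leP r 0; first by rewrite (le_trans r0)// !mulr_ge0// ltW.
  have := ball2_radius c d0 r0; rewrite BO OE lee_fin => h.
  have : (r / d%:R) ^+ (d * 2) <= (2 * s) ^+ (d * 2).
    rewrite exprM (le_trans h)// exprM exprMn exprMn -[leLHS]mulr_natl.
    rewrite ler_wpM2r ?sqr_ge0// -exprM -[leLHS]expr1 ler_weXn2l ?ler1n//.
    by rewrite muln_gt0 d0.
  rewrite ler_pXn2r ?muln_gt0 ?d0 ?nnegrE//.
  - by rewrite ler_pdivrMr// mulrAC.
  - by rewrite divr_ge0// ltW.
  - by rewrite mulr_ge0// ltW.
have mY : measurable (two_cubes s `+` ball2 c r).
  by rewrite setY_def; apply: measurableU; exact: measurableD.
have fY : mu2 (two_cubes s `+` ball2 c r) \is a fin_num.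
  rewrite ge0_fin_numE//; apply: (@le_lt_trans _ _ (mu2 (two_cubes s `|` ball2 c r))).
    apply: le_measure; rewrite ?inE//; first exact: measurableU.
    by rewrite setYE; exact: subDsetl.
  apply: (le_lt_trans (measureU2 _ _ _)) => //.
  have tO : (mu2 (two_cubes s) < +oo)%E by rewrite OE ltry.
  have tB : (mu2 (ball2 c r) < +oo)%E by rewrite BO.
  by apply: lte_add_pinfty; [exact: tO|exact: tB].
rewrite -lee_fin fineK//.
have [miss|miss] := ball2_miss_cube c rs.
- rewrite -(lebesgue2_near_cube (ltW s0)); apply: le_measure; rewrite ?inE//.
    exact: measurable_box.
  by move=> z zQ; rewrite setY_def; left; split; [left|exact: miss].
- rewrite -(lebesgue2_far_cube (ltW s0)); apply: le_measure; rewrite ?inE//.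
    exact: measurable_box.
  by move=> z zQ; rewrite setY_def; left; split; [right|exact: miss].
Qed.

End two_cubes.

(** [symm_ball] is a ball of measure t or, as the default value of a choice, the
    empty set; in both cases its measure is at most t. *)
Lemma hsnormsq_symm_ball_le (R : realType) (d : nat)
    (Omega : set (Rn R d * Rn R d)) (t : R) : 0 < t ->
  lebesgue2 R d Omega = t%:E ->
  (hsnormsq (lebesgue R d) (locop (symm_ball Omega)) <= (t ^+ 2)%:E)%E.
Proof.
move=> t0 Ot; rewrite /symm_ball; case: xgetP => [B _ [[r ->] BO]|_].
  by apply: hsnormsq_locop_le => //; [exact: measurable_ball2|rewrite BO Ot].
by apply: hsnormsq_locop_le => //; rewrite measure0 lee_fin ltW.
Qed.

Theorem mainTheorem6 (R : realType) (d : nat) (hd : (1 <= d)%N)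
    (c1 : R) (hc1 : 0 < c1)
    (beta : R -> R) (hbeta : forall t, 0 < t -> 0 <= beta t)
    (hstab : forall Omega : set (Rn R d * Rn R d),
      measurable Omega -> (0 < lebesgue2 R d Omega < +oo)%E ->
      (hsnormsq (lebesgue R d) (locop Omega) <=
       hsnormsq (lebesgue R d) (locop (symm_ball Omega)) -
       (c1 * beta (fine (lebesgue2 R d Omega)) * fraenkel Omega ^+ 2)%:E)%E) :
  exists C t0 : R, [/\ 0 < C, 0 < t0 &
    forall t : R, 0 < t < t0 -> beta t <= C * t `^ (2 + d%:R^-1)].
Proof.
(* K s^2 bounds |z|^2 on the two cubes, and D |z|^2 bounds the relative loss. *)
pose K : R := 2 * d%:R * (4 * d%:R + 2) ^+ 2.
pose D : R := 8 * pi * gauss_cst (R := R) (d := d) ^+ 2.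
have dR : 0 < d%:R :> R by rewrite ltr0n.
have K0 : 0 < K.
  apply: mulr_gt0; first by rewrite mulr_gt0.
  by rewrite exprn_gt0// ltr_wpDl// mulr_ge0// ler0n.
have D0 : 0 < D.
  apply: mulr_gt0; first by rewrite mulr_gt0// pi_gt0.
  by rewrite exprn_gt0// gauss_cst_gt0.
exists (4 * (D * K) / c1), 1; split => //.
  by apply: divr_gt0 => //; apply: mulr_gt0 => //; exact: mulr_gt0.
move=> t /andP[t0 _].
pose s : R := (t / 2) `^ ((d * 2)%:R^-1).
have s0 : 0 < s by rewrite powR_gt0// divr_gt0.
have sE : s ^+ d ^+ 2 *+ 2 = t.
  rewrite -exprM -powR_mulrn ?powR_ge0// -powRrM mulVf ?powRr1//.
  - by rewrite -mulr_natr divfK.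
  - by rewrite divr_ge0// ltW.
  - by rewrite pnatr_eq0 muln_eq0 negb_or -lt0n hd.
have s2 : s ^+ 2 <= t `^ (d%:R^-1).
  rewrite -powR_mulrn ?powR_ge0// -powRrM natrM invfM -mulrA mulVf// mulr1.
  by apply: ge0_ler_powR; rewrite ?nnegrE ?invr_ge0 ?ler0n//; lra.
have OE := lebesgue2_two_cubes hd s0; rewrite sE in OE.
have mO : measurable (two_cubes s) := @measurable_two_cubes R d s.
have fO : (lebesgue2 R d (two_cubes s) < +oo)%E by rewrite OE ltry.
have := hsnormsq_locop_gaussian_ge mO fO (fun z => two_cubes_bounded s0).
rewrite OE /= -/K -/D => lower.
have := hstab _ mO; rewrite OE lte_fin t0 ltry => /(_ isT) stab.
have upper := hsnormsq_symm_ball_le t0 OE.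
have := le_trans lower (le_trans stab (leeB upper (lexx _))).
rewrite -EFinB lee_fin /=; set a := fraenkel _ => key.
have a2 : 4^-1 <= a ^+ 2.
  have := fraenkel_two_cubes_ge hd s0; rewrite -/a => ha.
  have : 0 <= (a - 2^-1) * (a + 2^-1) by apply: mulr_ge0; lra.
  by lra.
have b0 := hbeta _ t0.
have step : c1 * beta t <= 4 * (D * K * s ^+ 2) * t ^+ 2.
  have : c1 * beta t * 4^-1 <= c1 * beta t * a ^+ 2.
    by rewrite ler_wpM2l// mulr_ge0// ltW.
  by lra.
rewrite powRD; last by rewrite gt_eqF ?implybT// t0.
rewrite -(ler_pM2l hc1) (le_trans step)//.
rewrite (powR_mulrn _ (ltW t0)).
rewrite [leRHS](_ : _ = 4 * (D * K * t `^ d%:R^-1) * t ^+ 2); last first.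
  by field; rewrite gt_eqF.
by rewrite ler_wpM2r ?sqr_ge0// ler_wpM2l// ler_wpM2l// mulr_ge0// ltW.
Qed.
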